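(* Fix an integer $\ell\ge3$ and let $G\sim G(n,n^{-\alpha})$ be an Erdős–Rényi random graph. Let $(a,b)\in V^2$ be any pair of vertices. As $n\to\infty$, in the regimes of $\alpha$ where both $ET_{\le\ell}(a,b)$ and $ET_{\le\ell-1}(a,b)$ are shellable, $EMH_{k,\ell}(a,b)$ is torsion free for every $k$. That is: if $\alpha$ is such that asymptotically almost surely both $ET_{\le\ell}(a,b)$ and $ET_{\le\ell-1}(a,b)$ are shellable, then asymptotically almost surely the abelian group $EMH_{k,\ell}(a,b)$ is torsion free for every $k$.
   Context: Graphs are simple and undirected; $d(u,v)$ is the length of a shortest path from $u$ to $v$, with $d(u,v)=\infty$ if $u,v$ lie in different components. For a tuple of vertices, $\mathrm{len}(y_0,\dots,y_m)=d(y_0,y_1)+\cdots+d(y_{m-1},y_m)$. $G(n,p)$ is the probability space of graphs on the vertex set $V=\{1,\dots,n\}$ in which each of the $\binom n2$ possible edges is present independently with probability $p$; here $p=n^{-\alpha}$ with $\alpha\in[0,\infty)$. ''Asymptotically almost surely'' means with probability tending to $1$ as $n\to\infty$. Eulerian magnitude homology: for vertices $a,b$ of $G=(V,E)$, $EMC_{k,\ell}(a,b)$ is the free abelian group generated by tuples $(x_0,\dots,x_k)\in V^{k+1}$ with $x_0=a$, $x_k=b$, all $x_i$ pairwise distinct, and $\mathrm{len}(x_0,\dots,x_k)=\ell$. The differential $\partial_{k,\ell}:EMC_{k,\ell}(a,b)\to EMC_{k-1,\ell}(a,b)$ is $\partial_{k,\ell}=\sum_{i=1}^{k-1}(-1)^i\partial^i_{k,\ell}$,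 where $\partial^i_{k,\ell}(x_0,\dots,x_k)=(x_0,\dots,\widehat{x_i},\dots,x_k)$ if $\mathrm{len}(x_0,\dots,\widehat{x_i},\dots,x_k)=\ell$, and $0$ otherwise. This is a chain complex, and $EMH_{k,\ell}(a,b)=H_k(EMC_{*,\ell}(a,b))=\ker\partial_{k,\ell}/\operatorname{im}\partial_{k+1,\ell}$. For an integer $L$, $ET_{\le L}(a,b)$ is the set of all tuples $(x_1,\dots,x_t)\in V^t$, $t\ge1$, such that $a,x_1,\dots,x_t,b$ are pairwise distinct and $\mathrm{len}(a,x_1,\dots,x_t,b)\le L$. It is regarded as a simplicial complex as follows: the tuple $(x_1,\dots,x_t)$ is a simplex of dimension $t-1$, whose faces are its nonempty (order-preserving) subtuples; these again belong to $ET_{\le L}(a,b)$ by the triangle inequality. (Tuples with the same entries in different orders are different simplices.) Facets are the simplices that are maximal with respect to the face relation. A shelling of a finite complex $X$ is an ordering $F_1,\dots,F_s$ of its facets such that, for every $k\ge2$, $F_k\cap\bigcup_{i=1}^{k-1}F_i$ is a non-empty union of facets (codimension-one faces) of $F_k$. The complex $X$ (not necessarily pure) is shellable if it has a shelling. *)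

(* Defs.v *)
From HB Require Import structures.
From mathcomp Require Import all_boot all_order all_algebra.
From mathcomp Require Import all_classical all_reals all_analysis.

Set Implicit Arguments.
Unset Strict Implicit.
Unset Printing Implicit Defensive.

Import Order.TTheory GRing.Theory Num.Theory.
Import numFieldNormedType.Exports.

Local Open Scope classical_set_scope.
Local Open Scope ring_scope.

(* A simple graph on 'I_n is the set of its edges, each edge being a
   two-element set of vertices. *)
Definition sgraph (n : nat) : Type :=
  {E : {set {set 'I_n}} | [forall e in E, #|e| == 2%N]}.
HB.instance Definition _ n := Finite.on (sgraph n).

Section Distance.
Variables (n : nat) (g : sgraph n).

Definition adj : rel 'I_n := fun u v => [set u; v]%SET \in val g.

Definition walk (u v : 'I_n) (m : nat) : bool :=
  [exists p : m.-tuple 'I_n, path adj u p && (last u p == v)].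

Lemma connect_walk u v : connect adj u v -> exists m, walk u v m.
Proof.
case/connectP=> p up ->; exists (size p); apply/existsP.
by exists (in_tuple p); rewrite up eqxx.
Qed.

(* Distances and lengths live in option nat, None standing for infinity. *)
Definition dist (u v : 'I_n) : option nat :=
  if @idP (connect adj u v) is ReflectT uv
  then Some (ex_minn (connect_walk uv)) else None.

Definition addo (x y : option nat) : option nat :=
  if (x, y) is (Some i, Some j) then Some (i + j)%N else None.

Definition leo (x : option nat) (L : nat) : bool :=
  if x is Some i then (i <= L)%N else false.

Definition len (s : seq 'I_n) : option nat :=
  if s is y :: s' then foldr addo (Some 0%N) (pairmap dist y s') else Some 0%N.

End Distance.

Section EulerianMagnitudeHomology.
Variables (n : nat) (g : sgraph n) (l : nat) (a b : 'I_n).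

Definition eulerian k (x : k.+1.-tuple 'I_n) : bool :=
  [&& tnth x ord0 == a, tnth x ord_max == b, uniq x & len g x == Some l].

Definition egen k : Type := {x : k.+1.-tuple 'I_n | eulerian x}.
HB.instance Definition _ k := Finite.on (egen k).

(* The free abelian group on the finite set egen k. *)
Definition EMC k : Type := {ffun egen k -> int}.
HB.instance Definition _ k := GRing.Zmodule.on (EMC k).

Definition egen_basis k (x : egen k) : EMC k := [ffun y => (y == x)%:R].

Definition del k (i : 'I_k.+2) (x : k.+2.-tuple 'I_n) : k.+1.-tuple 'I_n :=
  [tuple tnth x (lift i j) | j < k.+1].

(* For 0 < i < k.+1, del i x has distinct entries and the same endpoints as x,
   so that insub only tests whether its length is still l. *)
Definition bdry_i k (i : 'I_k.+2) (x : egen k.+1) : EMC k :=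
  if insub (del i (val x)) is Some y then egen_basis y else 0.

Definition bdryS k (c : EMC k.+1) : EMC k :=
  \sum_(x : egen k.+1)
    (\sum_(i < k.+2 | (0 < i < k.+1)%N) bdry_i i x *~ (-1) ^+ i) *~ c x.

Definition bdry k : EMC k -> EMC k.-1 :=
  match k with 0 => fun=> 0 | k'.+1 => @bdryS k' end.

Lemma bdry_is_zmod_morphism k : zmod_morphism (@bdry k).
Proof.
case: k => [|k] c d /=; first by rewrite subr0.
rewrite /bdryS -sumrB; apply: eq_bigr => x _.
by rewrite !ffunE mulrzBr.
Qed.

HB.instance Definition _ k :=
  GRing.isZmodMorphism.Build (EMC k) (EMC k.-1) (@bdry k)
    (@bdry_is_zmod_morphism k).

Definition is_cycle k : {pred EMC k} := [pred c | bdry c == 0].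

Lemma is_cycle_zmod_closed k : zmod_closed (@is_cycle k).
Proof.
split=> [|c d]; rewrite !inE ?raddf0 // => /eqP c0 /eqP d0.
by rewrite (raddfB (@bdry k)) /= c0 d0 subr0.
Qed.

HB.instance Definition _ k :=
  GRing.isZmodClosed.Build (EMC k) (@is_cycle k) (@is_cycle_zmod_closed k).

Record cycles k := Cycle { cycle_val : EMC k; _ : is_cycle cycle_val }.
HB.instance Definition _ k := [isSub of cycles k for @cycle_val k].
HB.instance Definition _ k := [Choice of cycles k by <:].
HB.instance Definition _ k := [SubChoice_isSubZmodule of cycles k by <:].

(* Every boundary is a cycle, so that this subgroup of the cycles is the whole
   image of bdry. *)
Definition is_boundary k : {pred cycles k} :=
  [pred z | `[< exists c : EMC k.+1, bdry c = val z >]].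

Lemma is_boundary_zmod_closed k : zmod_closed (@is_boundary k).
Proof.
split=> [|y z /asboolP[c cy] /asboolP[d dz]]; rewrite unfold_in /=.
  by apply/asboolP; exists 0; exact: (raddf0 (@bdry k.+1)).
apply/asboolP.
exists (c - d); apply: (etrans (raddfB (@bdry k.+1) c d)).
exact: (congr2 (fun u v => u - v) cy dz).
Qed.

HB.instance Definition _ k :=
  GRing.isZmodClosed.Build (cycles k) (@is_boundary k)
    (@is_boundary_zmod_closed k).

Definition EMH k : zmodType := Quotient.quot (@is_boundary k).

End EulerianMagnitudeHomology.

Definition torsion_free (A : zmodType) : Prop :=
  forall (x : A) (m : nat), (0 < m)%N -> x *+ m = 0 -> x = 0.

Definition ET n (g : sgraph n) (L : nat) (a b : 'I_n) : pred (seq 'I_n) :=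
  fun s => [&& s != [::], uniq (a :: rcons s b) & leo (len g (a :: rcons s b)) L].

Section Shellability.
Variables (T : eqType) (X : pred (seq T)).

Definition facet (s : seq T) : Prop :=
  X s /\ forall t, X t -> subseq s t -> t = s.

Definition codim1_face (r s : seq T) : bool :=
  subseq r s && ((size r).+1 == size s).

(* Subcomplexes of a simplex are given here with their empty face: s ranges
   over all subtuples, [::] included.  For simplices of positive dimension this
   is immaterial; the codimension-one face of a vertex is the empty simplex, so
   that complexes of dimension 0 are shellable, as is usual. *)
Definition shelling (F : seq (seq T)) : Prop :=
  [/\ uniq F,
      forall s, s \in F <-> facet s &
      forall k, (0 < k < size F)%N ->
        exists R : seq (seq T),
          [/\ R != [::],
              forall r, r \in R -> codim1_face r (nth [::] F k) &
              forall s, (subseq s (nth [::] F k) &&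
                         has (subseq s) (take k F)) = has (subseq s) R]].

Definition shellable : Prop := exists F, shelling F.

End Shellability.

Section RandomGraph.
Variable R : realType.

Definition gnp_prob (n : nat) (p : R) (P : sgraph n -> Prop) : R :=
  \sum_(g : sgraph n | `[< P g >])
    \prod_(e : {set 'I_n} | #|e| == 2%N) (if e \in val g then p else 1 - p).

(* Graphs have n.+1 vertices, so that vertices can be chosen for every n. *)
Definition aas (alpha : R) (P : forall n : nat, sgraph n.+1 -> Prop) : Prop :=
  (fun n : nat => gnp_prob (n.+1%:R `^ (- alpha)) (@P n)) @ \oo --> (1 : R).

End RandomGraph.

(* Main.v *)
(* Write p = n^-alpha for the edge probability.

   If alpha < 1/2, then a.a.s. any two vertices have more than l + 1 common
   neighbours, so that every simplex of ET_{<=l} and ET_{<=l-1} extends to one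
   with l - 1, respectively l - 2, vertices: both complexes are pure.  A pure
   shellable complex has no reduced homology below its dimension (each facet of
   a shelling is coned off, or closes a top-dimensional cycle).  As
   EMC_{*,l} = C(ET_{<=l}) / C(ET_{<=l-1}) up to a shift, EMH_{k,l} vanishes for
   k < l, and EMH_{l,l} is a group of cycles, hence free.

   If alpha > (l-1)/l, then a.a.s. a = b or d(a,b) > l by a first moment
   estimate, and EMC_{*,l}(a,b) = 0.

   If 1/2 <= alpha <= (l-1)/l, then the hypothesis fails unless a = b.  By the
   second moment method there are, with probability bounded below, two
   internally disjoint paths of length l from a to b whose union is an induced
   cycle such that every other vertex has at most one neighbour on it.  Each
   path is then a facet of ET_{<=l} sharing no codimension-one face with another
   facet, and a shelling has room for at most one such facet.

   For a given graph, shellability of the two complexes does not imply that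
   EMH_{k,l} is torsion free when they are not pure, whence the distinction of
   cases on alpha. *)

Require Import Defs.
From mathcomp Require Import all_boot all_order all_algebra.
From mathcomp Require Import all_classical all_reals all_analysis.
From mathcomp Require Import zify ring lra.
(* Re-imported so that the finite versions of the shared lemma names (of
   [subsetP], [setIC], [filter], and so on) are the visible ones. *)
From mathcomp Require Import seq fintype finset.

Set Implicit Arguments.
Unset Strict Implicit.
Unset Printing Implicit Defensive.
Import Order.TTheory GRing.Theory Num.Theory.
Import numFieldNormedType.Exports.
Local Open Scope ring_scope.
Local Arguments len : simpl never.

(** * Chains and shellings *)

Section Chains.
Variable T : finType.
Implicit Types (s t : seq T) (f g : seq T -> int).

Definition ins i (y : T) s := take i s ++ y :: drop i s.

Lemma size_ins i y s : size (ins i y s) = (size s).+1.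
Proof. by rewrite size_cat /= addnS -size_cat cat_take_drop. Qed.

Lemma mem_ins i y s x : (x \in ins i y s) = (x == y) || (x \in s).
Proof. by rewrite mem_cat inE orbCA -mem_cat cat_take_drop. Qed.

Lemma uniq_ins i y s : uniq (ins i y s) = (y \notin s) && uniq s.
Proof. by rewrite /ins -cat1s uniq_catCA /= cat_take_drop. Qed.

Lemma subseq_ins i y s : subseq s (ins i y s).
Proof.
by rewrite -{1}(cat_take_drop i s) cat_subseq ?subseq_refl ?subseq_cons.
Qed.

(** Dual to the simplicial identities; this pairing of insertions makes the double boundary
    cancel. *)
Lemma ins_ins i j y z s : (j <= i <= size s)%N ->
  ins j z (ins i y s) = ins i.+1 y (ins j z s).
Proof.
case/andP=> ji si; rewrite /ins.
have sj : size (take j s) = j by rewrite size_takel // (leq_trans ji).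
have st : size (take i s) = i by rewrite size_takel.
rewrite [in LHS]take_cat [in LHS]drop_cat [in RHS]take_cat [in RHS]drop_cat.
rewrite st sj [(i.+1 < j)%N]ltnNge (leq_trans ji) ?leqnSn //= subSn //=.
move: ji; rewrite leq_eqVlt => /orP[/eqP->|ji].
  by rewrite ltnn subnn !take0 !drop0 cats0 -catA.
rewrite ji take_takel ?(ltnW ji) // take_drop subnK ?(ltnW ji) //.
by rewrite drop_drop subnK ?(ltnW ji) // -catA.
Qed.

(* A chain is recorded by its coefficient function; the coefficient of [s] in
   its boundary collects the one-vertex extensions of [s]. *)
Definition bd f s : int :=
  \sum_(i < (size s).+1) \sum_(y : T) (-1) ^+ i * f (ins i y s).

(** The entry [(i, j)] with [j <= i] is paired with [(j, i + 1)], which lies strictly above the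
    diagonal and carries the opposite sign. *)
Lemma alternating_double_sum n (A : nat -> nat -> int) :
  (forall i j, (j <= i <= n)%N -> A i j = A j i.+1) ->
  \sum_(i < n.+1) \sum_(j < n.+2) (-1) ^+ (i + j) * A i j = 0.
Proof.
move=> AE.
have low i : (i < n.+1)%N ->
    \sum_(j < n.+2 | (j <= i)%N) (-1) ^+ (i + j) * A i j =
    \sum_(j < n.+1 | (j <= i)%N) (-1) ^+ (i + j) * A j i.+1.
  move=> ni; rewrite big_mkcond big_ord_recr /= leqNgt ni addr0 -big_mkcond /=.
  by apply: eq_bigr => j ji; rewrite AE // ji.
have high i : \sum_(j < n.+2 | ~~ (j <= i)%N) (-1) ^+ (i + j) * A i j =
    - \sum_(j < n.+1 | (i <= j)%N) (-1) ^+ (j + i) * A i j.+1.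
  rewrite big_mkcond big_ord_recl /= add0r -sumrN [RHS]big_mkcond /=.
  apply: eq_bigr => j _; rewrite /bump /= -ltnNge add1n ltnS.
  by case: ifP => // _; rewrite addnS exprS mulN1r mulNr addnC.
under eq_bigr => i _.
  rewrite (bigID (fun j : 'I_n.+2 => (j <= i)%N)) /= (low i (ltn_ord i)) high.
over.
rewrite big_split /= sumrN (exchange_big_dep xpredT) //=.
by apply/eqP; rewrite subr_eq0; apply/eqP/eq_bigr => i _; apply: eq_bigr.
Qed.

Lemma bd_bd f s : bd (bd f) s = 0.
Proof.
pose A i j := \sum_(y : T) \sum_(z : T) f (ins j z (ins i y s)).
rewrite -[RHS](@alternating_double_sum (size s) A) => [|i j ij].
  apply: eq_bigr => i _; under eq_bigr => y _ do
    rewrite /bd size_ins mulr_sumr.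
  rewrite exchange_big /=; apply: eq_bigr => j _.
  rewrite /A mulr_sumr; apply: eq_bigr => y _; rewrite !mulr_sumr.
  by apply: eq_bigr => z _; rewrite exprD mulrA.
rewrite /A exchange_big /=; apply: eq_bigr => y _.
by apply: eq_bigr => z _; rewrite ins_ins.
Qed.

Lemma bdB f g s : bd (fun t => f t - g t) s = bd f s - bd g s.
Proof.
rewrite /bd -sumrB; apply: eq_bigr => i _; rewrite -sumrB.
by apply: eq_bigr => y _; rewrite mulrBr.
Qed.

Lemma bdD f g s : bd (fun t => f t + g t) s = bd f s + bd g s.
Proof.
rewrite /bd -big_split; apply: eq_bigr => i _; rewrite -big_split.
by apply: eq_bigr => y _; rewrite mulrDr.
Qed.

Lemma bd_neq0 f s : bd f s != 0 -> exists i y, f (ins i y s) != 0.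
Proof.
move=> bs; suff /existsP[i /existsP[y fs]] :
  [exists i : 'I_(size s).+1, exists y, f (ins i y s) != 0] by exists i, y.
apply: contraNT bs => /existsPn f0; apply/eqP.
apply: big1 => i _; apply: big1 => y _.
by move/existsPn: (f0 i) => /(_ y)/negPn/eqP ->; rewrite mulr0.
Qed.

Lemma subseq_uniqE s t : uniq t -> subseq s t -> s = seq.filter (mem s) t.
Proof. by move=> ut /(subseq_uniqP ut). Qed.

(* Inside a simplex [t], the only way to add the vertex [v] to [s] is to put it
   at its place in [t]. *)
Lemma bd_cone (c : seq T) v t f : uniq t -> subseq c t -> v \in c ->
    (forall i y, f (ins i y (rem v c)) != 0 ->
       y = v /\ subseq (ins i y (rem v c)) t) ->
  bd f (rem v c) = (-1) ^+ index v c * f c.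
Proof.
move=> ut ct vc fv.
have uc : uniq c by exact: subseq_uniq ct ut.
have sz : size (rem v c) = (size c).-1 by exact: size_rem.
have ic : (index v c < (size (rem v c)).+1)%N.
  by rewrite sz prednK ?index_mem //; case: (c) vc.
have insE : ins (index v c) v (rem v c) = c.
  elim: (c) vc {uc ct fv sz ic} => //= x c' IH.
  rewrite inE [v == x]eq_sym; case: eqVneq => [-> _|xv /= vc].
    by rewrite /ins take0 drop0.
  by congr cons; apply: IH.
(* A subtuple of the duplicate-free [t] is determined by its vertex set, so a single position of [v]
   keeps the result inside [t]. *)
have uniqi i : (i <= size (rem v c))%N ->
    subseq (ins i v (rem v c)) t -> i = index v c.
  move=> ir it; have : ins i v (rem v c) = c.
    rewrite (subseq_uniqE ut it) [RHS](subseq_uniqE ut ct).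
    apply: eq_filter => x /=; rewrite mem_ins mem_rem_uniq // inE.
    by case: eqVneq => [->|].
  move=> cE; have := uc; rewrite -{1}cE uniq_ins => /andP[vr _].
  rewrite -[in RHS]cE /ins index_cat.
  case: ifPn => [/mem_take vt|_]; first by rewrite vt in vr.
  by rewrite /= eqxx addn0 size_takel.
rewrite /bd (bigD1 (Ordinal ic)) //= [X in _ + X]big1 ?addr0 => [|i ni].
  rewrite (bigD1 v) //= insE [X in _ + X]big1 ?addr0 // => y yv.
  have [->|/fv[yE]] := eqVneq (f (ins (index v c) y (rem v c))) 0.
    by rewrite mulr0.
  by rewrite yE eqxx in yv.
apply: big1 => y _.
have [->|/fv[-> it]] := eqVneq (f (ins i y (rem v c))) 0; first by rewrite mulr0.
by case/eqP: ni; apply: val_inj; apply: (uniqi i _ it); rewrite -ltnS.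
Qed.

(** Induction on the number of facets. [J] lists the vertices opposite to the faces along which a
    facet is attached, so its new faces are those containing [J]. If [J] exhausts the facet, the
    facet itself is the only new face, and [f], supported on smaller tuples, misses it; otherwise
    the new faces form a cone. The empty tuple counts as a simplex, so the homology is reduced. *)
Lemma shelling_acyclic (F : seq (seq T)) (d : nat) :
    (forall s, s \in F -> uniq s /\ size s = d) ->
    (forall k, (k < size F)%N -> exists J : seq T,
       forall s, subseq s (nth [::] F k) ->
         has (subseq s) (take k F) = has (fun x => x \notin s) J) ->
  forall f, (forall s, f s != 0 -> has (subseq s) F /\ (size s < d)%N) ->
    (forall s, bd f s = 0) ->
  exists g, (forall s, g s != 0 -> has (subseq s) F) /\ bd g =1 f.
Proof.
move=> Fd shF f fF f0.
suff acyclic k : (k <= size F)%N ->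
    forall f, (forall s, f s != 0 -> has (subseq s) (take k F) /\ (size s < d)%N) ->
      (forall s, bd f s = 0) ->
    exists g, (forall s, g s != 0 -> has (subseq s) (take k F)) /\ bd g =1 f.
  have := acyclic _ (leqnn _) f; rewrite take_size; exact.
elim: k {f fF f0} => [|k IH] kF f fF f0.
  exists f; rewrite take0 in fF *; split=> [s /fF[]//|s].
  by rewrite f0; apply/esym/eqP; apply: contraT => /fF[].
have takeE s : has (subseq s) (take k.+1 F) =
    has (subseq s) (take k F) || subseq s (nth [::] F k).
  by rewrite (take_nth [::]) // has_rcons orbC.
have [uk sk] := Fd _ (mem_nth [::] kF).
have [J JE] := shF k kF; set Fk := nth [::] F k in takeE uk sk JE.
pose new s := subseq s Fk && all (mem s) J.
have newE s : has (subseq s) (take k.+1 F) -> ~~ has (subseq s) (take k F) -> new s.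
  rewrite takeE /new => /orP[->//|sFk]; rewrite sFk JE // -all_predC.
  by move/allP=> sJ; apply/allP=> x /sJ /=; rewrite negbK.
(* A cycle vanishing on the new faces is supported on the earlier facets, where the induction
   hypothesis fills it. *)
have restrict (h : seq T -> int) :
    (forall s, h s != 0 -> has (subseq s) (take k.+1 F) /\ (size s < d)%N) ->
    (forall s, new s -> h s = 0) -> (forall s, bd h s = 0) ->
    exists g, (forall s, g s != 0 -> has (subseq s) (take k.+1 F)) /\ bd g =1 h.
  move=> hF hnew h0; case: (IH (ltnW kF) h) => // [s hs|g [gF gh]].
    have [sF sd] := hF s hs; split=> //; apply: contraT => /(newE _ sF)/hnew.
    by move/eqP; rewrite (negPf hs).
  by exists g; split=> // s /gF; rewrite takeE => ->.
case: (boolP (all (mem J) Fk)) => [/allP FJ|/allPn[v vF vJ]].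
  apply: restrict => // s /andP[sF /allP sJ]; apply/eqP/contraT => /fF[_].
  suff -> : s = Fk by rewrite sk ltnn.
  rewrite (subseq_uniqE uk sF); apply/all_filterP/allP => x /FJ; exact: sJ.
have new_rem s : new s -> new (rem v s).
  case/andP=> sF /allP sJ; have us := subseq_uniq sF uk.
  rewrite /new (subseq_trans (rem_subseq v s) sF); apply/allP=> x xJ /=.
  rewrite mem_rem_uniq // inE; have := sJ x xJ; rewrite /= => ->; rewrite andbT.
  by apply: contraNneq vJ => <-.
(* Coning over [v] removes the new simplices avoiding [v]; the coefficients of
   the others are then read off the boundary of their face opposite to [v]. *)
pose g t : int := if new t && (v \in t) then (-1) ^+ index v t * f (rem v t) else 0.
pose h t : int := f t - bd g t.
have gF t : g t != 0 -> [/\ new t, v \in t & f (rem v t) != 0].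
  rewrite /g; case: (boolP (new t)) => nt; case: (boolP (v \in t)) => vt //=.
  by rewrite mulf_eq0 negb_or => /andP[].
have hF s : h s != 0 -> has (subseq s) (take k.+1 F) /\ (size s < d)%N.
  rewrite /h; have [fs|/fF//] := eqVneq (f s) 0; rewrite fs sub0r oppr_eq0.
  case/bd_neq0=> i [y /gF[/andP[nF _] vi /fF[_ sz]]]; split.
    by rewrite takeE (subseq_trans (subseq_ins i y s) nF) orbT.
  by move: sz; rewrite size_rem // size_ins.
have h0 s : bd h s = 0 by rewrite bdB f0 bd_bd subr0.
have new_ins s : v \notin s -> new s -> exists c,
    [/\ new c, v \in c & s = rem v c].
  move=> vs /andP[sF /allP sJ]; exists (seq.filter (mem (v :: s)) Fk).
  have vc : v \in seq.filter (mem (v :: s)) Fk by rewrite mem_filter /= inE eqxx vF.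
  rewrite /new filter_subseq vc; split=> //=.
    apply/allP=> x /sJ /= xs; rewrite mem_filter /= inE xs orbT.
    exact: (mem_subseq sF).
  rewrite rem_filter ?filter_uniq // -filter_predI (subseq_uniqE uk sF).
  apply: eq_in_filter => x xF /=; rewrite inE mem_filter xF andbT.
  by case: eqVneq => [->|]; rewrite /= ?(negPf vs).
have hv s : v \notin s -> new s -> h s = 0.
  move=> vs ns; have [c [nc vc sE]] := new_ins s vs ns.
  have /andP[cF _] := nc.
  rewrite /h sE (@bd_cone c v Fk) // => [|i y].
  - by rewrite /g vc nc /= signrMK subrr.
  case/gF=> /andP[iF _] + _; rewrite mem_ins -sE (negPf vs) orbF => /eqP->.
  by rewrite sE.
have [g' [g'F g'h]] : exists g,
    (forall s, g s != 0 -> has (subseq s) (take k.+1 F)) /\ bd g =1 h.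
  apply: restrict => // c nc; have /andP[cF _] := nc.
  case: (boolP (v \in c)) => [vc|]; last by move/hv; apply.
  have := h0 (rem v c); rewrite (@bd_cone c v Fk) // => [|i y hi].
  - by move/eqP; rewrite mulf_eq0 signr_eq0 /= => /eqP.
  have [iF _] := hF _ hi.
  (* [rem v c] contains [J], so it lies in no earlier facet, and neither does a tuple extending
     it. *)
  have /(newE _ iF) ni : ~~ has (subseq (ins i y (rem v c))) (take k F).
    apply/negP=> /hasP[t tF ti]; have /andP[rF /allP rJ] := new_rem c nc.
    have : has (subseq (rem v c)) (take k F).
      by apply/hasP; exists t => //; apply: subseq_trans ti; apply: subseq_ins.
    by rewrite JE // => /hasP[x /rJ /= ->].
  have /andP[niF _] := ni; split=> //; apply/eqP; apply: contraNT hi => yv.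
  apply/eqP/hv => //; rewrite mem_ins eq_sym (negPf yv) /= mem_rem_uniq.
    by rewrite inE eqxx.
  exact: subseq_uniq cF uk.
exists (fun t => g t + g' t); split=> [s|s].
  have [gs|/gF[/andP[sF _] _ _]] := eqVneq (g s) 0.
    by rewrite gs add0r => /g'F.
  by rewrite takeE sF orbT.
by rewrite bdD g'h /h addrC subrK.
Qed.

End Chains.

(** * Distances and lengths *)

Lemma torsion_free_EMH n (g : sgraph n) l (a b : 'I_n) k :
  (forall (z : EMC g l a b k) m, (0 < m)%N -> bdry z = 0 ->
     (exists c : EMC g l a b k.+1, bdry c = z *+ m) ->
     exists c : EMC g l a b k.+1, bdry c = z) ->
  torsion_free (EMH g l a b k).
Proof.
move=> H x m m0; elim/quotW: x => z zm.
pose pi := \pi_(EMH g l a b k)%qT.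
have pi0 : pi 0 = 0 by exact: raddf0.
have /eqP : pi (z *+ m) = pi 0 by rewrite pi0 -[RHS]zm; exact: raddfMn.
rewrite -Quotient.idealrBE subr0 => /asboolP[c cz].
apply: etrans pi0; apply/eqP; rewrite -Quotient.idealrBE subr0.
apply/asboolP; apply: (H (val z) m) => //; first by apply/eqP; exact: valP z.
by exists c; rewrite cz; exact: (raddfMn val).
Qed.

Lemma torsion_free_EMH_egen0 n (g : sgraph n) l (a b : 'I_n) k :
  (egen g l a b k -> False) -> torsion_free (EMH g l a b k).
Proof.
move=> k0; apply: torsion_free_EMH => z m _ _ _; exists 0.
by rewrite raddf0; apply/ffunP=> x; case: (k0 x).
Qed.

(** All boundaries vanish, so the homology is a subgroup of a free abelian group. *)
Lemma torsion_free_EMH_egenS0 n (g : sgraph n) l (a b : 'I_n) k :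
  (egen g l a b k.+1 -> False) -> torsion_free (EMH g l a b k).
Proof.
move=> k0; apply: torsion_free_EMH => z m m0 _ [c cz]; exists 0.
have c0 : c = 0 by apply/ffunP=> x; case: (k0 x).
rewrite raddf0; apply/ffunP=> x; move/ffunP: cz => /(_ x).
rewrite c0 raddf0 ffunMnE !ffunE => /esym/eqP.
by rewrite mulrn_eq0 eqn0Ngt m0 /= => /eqP.
Qed.

(** * Length bounds for tuples *)

Section Length.
Variables (n : nat) (g : sgraph n).
Implicit Types (u v w x y : 'I_n) (s t : seq 'I_n).

Lemma adj_sym u v : adj g u v = adj g v u.
Proof. by rewrite /adj finset.setUC. Qed.

Lemma adj_irr u : adj g u u = false.
Proof.
apply/negP; rewrite /adj finset.setUid => uE.
by have /forall_inP/(_ _ uE) := valP g; rewrite cards1.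
Qed.

Lemma walkP u v m : reflect
  (exists p, [/\ path (adj g) u p, last u p = v & size p = m]) (walk g u v m).
Proof.
apply: (iffP existsP) => [[p /andP[up /eqP lp]]|[p [up lp sp]]].
  by exists p; rewrite up lp size_tuple.
by move/eqP: sp => sp; exists (Tuple sp); rewrite up lp eqxx.
Qed.

Lemma dist_leP u v L :
  reflect (exists2 m, (m <= L)%N & walk g u v m) (leo (dist g u v) L).
Proof.
rewrite /dist; case: {-}_ / idP => [uv|nuv] /=; last first.
  constructor=> -[m _ /walkP[p [up lp _]]]; apply: nuv.
  by apply/connectP; exists p.
case: ex_minnP => m wm minm; apply: (iffP idP) => [mL|[k kL /minm mk]].
  by exists m.
exact: leq_trans mk kL.
Qed.

(** A length budget is split between two summands; arguments about [len] then need no case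
    distinction on infinite distances. *)
Lemma leo_addoP (i j : option nat) L :
  reflect (exists2 k, (k <= L)%N & leo i k && leo j (L - k)) (leo (Defs.addo i j) L).
Proof.
case: i => [i|]; case: j => [j|]; apply: (iffP idP) => //=.
- by move=> ijL; exists i; lia.
- by case=> k kL; lia.
- by case=> k _; rewrite andbF.
- by case.
- by case.
Qed.

Lemma leo_add (i j : option nat) k m :
  leo i k -> leo j m -> leo (Defs.addo i j) (k + m).
Proof. by case: i => [i|]; case: j => [j|] //=; lia. Qed.

Lemma leo_trans (i : option nat) k m : (k <= m)%N -> leo i k -> leo i m.
Proof. by case: i => //= i km ik; apply: leq_trans km. Qed.

Lemma len_cons x y s : len g (x :: y :: s) = Defs.addo (dist g x y) (len g (y :: s)).
Proof. by []. Qed.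

Lemma dist_adj u v : adj g u v -> leo (dist g u v) 1.
Proof.
move=> uv; apply/dist_leP; exists 1 => //; apply/walkP.
by exists [:: v]; rewrite /= uv.
Qed.

Lemma dist_gt0 u v : u != v -> leo (dist g u v) 0 = false.
Proof.
move=> uv; apply/dist_leP=> -[m]; rewrite leqn0 => /eqP-> /walkP[p [_ lp]].
by move/size0nil=> p0; rewrite p0 /= in lp; rewrite lp eqxx in uv.
Qed.

Lemma dist_le1 u v : u != v -> leo (dist g u v) 1 -> adj g u v.
Proof.
move=> uv /dist_leP[m m1 /walkP[p [up lp sp]]].
case: p up lp sp => [|x [|y p]] /=; first by move=> _ uE; rewrite uE eqxx in uv.
  by rewrite andbT => ux <-.
by move=> _ _ sp; lia.
Qed.

Lemma dist_triangle u v w i j :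
  leo (dist g u v) i -> leo (dist g v w) j -> leo (dist g u w) (i + j).
Proof.
case/dist_leP=> k ki /walkP[p [up lp sp]] /dist_leP[m mj /walkP[q [vq lq sq]]].
apply/dist_leP; exists (k + m)%N; first by lia.
apply/walkP; exists (p ++ q).
by rewrite cat_path up lp vq last_cat lp lq size_cat sp sq.
Qed.

(** Triangle inequality at the inserted vertex. *)
Lemma len_ins x s b i y L : leo (len g (x :: rcons (ins i y s) b)) L ->
  leo (len g (x :: rcons s b)) L.
Proof.
elim: s i x L => [|z s IH] i x L.
  rewrite /ins -[rcons _ _]/[:: y; b] => /leo_addoP[k kL /andP[xk]].
  case/leo_addoP=> m mL /andP[ym _]; apply/leo_addoP; exists (k + m)%N; first by lia.
  by rewrite (dist_triangle xk ym).
case: i => [|i].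
  case/leo_addoP=> k kL /andP[xk] /leo_addoP[m mL /andP[ym zs]].
  rewrite /= len_cons; apply/leo_addoP; exists (k + m)%N; first by lia.
  by rewrite (dist_triangle xk ym) subnDA.
case/leo_addoP=> k kL /andP[xk] /IH zs; rewrite /= len_cons.
by apply/leo_addoP; exists k => //; rewrite xk.
Qed.

(** A subtuple is reached by deleting one vertex at a time; this carries facts about single
    deletions to arbitrary faces. *)
Lemma subseq_ind_ins (P : seq 'I_n -> Prop) :
  (forall i y s, P (ins i y s) -> P s) -> forall s t, subseq s t -> P t -> P s.
Proof.
move=> Pins s t st Pt; have [k] := ubnP (size t - size s)%N.
elim: k t st Pt => // k IH t st Pt szk.
have [sz|ts] := ltnP (size s) (size t); last first.
  by have /eqP -> : s == t by rewrite -(size_subseq_leqif st) eqn_leq ts size_subseq.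
have [i [y [r [sr tE]]]] : exists i y r, subseq s r /\ t = ins i y r.
  elim: t s st sz {Pt szk IH} => // x t IHt [|z s] /= st sz.
    by exists 0, x, t; rewrite /ins take0 drop0 sub0seq.
  case: eqVneq st => [zx|zx] st; last first.
    by exists 0, x, t; rewrite /ins take0 drop0.
  have [i [y [r [sr ->]]]] := IHt s st sz.
  by exists i.+1, y, (x :: r); rewrite zx /= eqxx.
apply: (IH r sr); first by apply: (Pins i y); rewrite -tE.
by move: szk; rewrite tE size_ins subSn // size_subseq.
Qed.

Lemma len_subseq a b s t L : subseq s t ->
  leo (len g (a :: rcons t b)) L -> leo (len g (a :: rcons s b)) L.
Proof.
apply: (subseq_ind_ins (P := fun r => leo (len g (a :: rcons r b)) L)) => i y r.
exact: len_ins.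
Qed.

(** Consecutive vertices are distinct, so every gap costs at least one. *)
Lemma size_le_len x s L : uniq (x :: s) -> leo (len g (x :: s)) L -> (size s <= L)%N.
Proof.
elim: s x L => // y s IH x L /=/andP[]; rewrite inE negb_or => /andP[xy _] us.
case/leo_addoP=> k kL /andP[xk /(IH y _ us) sz].
have : (0 < k)%N by rewrite lt0n; apply: contraTneq xk => ->; rewrite dist_gt0.
by lia.
Qed.

(** Equality case of the preceding count: every gap then costs exactly one, that is, it is an
    edge. *)
Lemma path_of_len x s L : uniq (x :: s) -> leo (len g (x :: s)) L ->
  (L <= size s)%N -> path (adj g) x s.
Proof.
elim: s x L => // y s IH x L /=/andP[]; rewrite inE negb_or => /andP[xy _] us.
case/leo_addoP=> k kL /andP[xk ys] Ls.
have sz := size_le_len us ys.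
have k0 : (0 < k)%N by rewrite lt0n; apply: contraTneq xk => ->; rewrite dist_gt0.
have k1 : k = 1%N by lia.
rewrite k1 in xk ys; rewrite dist_le1 //=; apply: IH ys _ => //; lia.
Qed.

Lemma len_of_path x s : path (adj g) x s -> leo (len g (x :: s)) (size s).
Proof.
elim: s x => // y s IH x /= /andP[xy /IH ys].
by rewrite len_cons -add1n leo_add // dist_adj.
Qed.

(* A gap of length at least two admits a common neighbour at no cost. *)
Lemma insert_nonadjacent (S : seq 'I_n) x s L :
    (forall u w, u != w -> exists y, [/\ y \notin S, adj g u y & adj g y w]) ->
    uniq (x :: s) -> leo (len g (x :: s)) L -> ~~ path (adj g) x s ->
  exists i y, [/\ (i < size s)%N, y \notin S & leo (len g (x :: ins i y s)) L].
Proof.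
move=> common; elim: s x L => // z s IH x L /andP[]; rewrite inE negb_or.
case/andP=> xz _ us /leo_addoP[k kL /andP[xk zs]] /=; rewrite negb_and.
case: (boolP (adj g x z)) => [xzE /= nzs|nxz _].
  have [i [y [si yS zi]]] := IH z _ us zs nzs; exists i.+1, y; split=> //.
  by apply/leo_addoP; exists k => //; rewrite xk.
have [y [yS xy yz]] := common _ _ xz; exists 0, y; split=> //.
rewrite /ins take0 drop0 /=.
have k2 : (1 < k)%N.
  case: k xk {kL zs} => [|[|k]] //; first by rewrite dist_gt0.
  by move/(dist_le1 xz); rewrite (negPf nxz).
have -> : L = (1 + (1 + (L - 2)))%N by lia.
rewrite !len_cons !leo_add ?dist_adj //; apply: leo_trans zs; lia.
Qed.

End Length.

(** * The complexes of Eulerian tuples *)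

Lemma ins_rcons (T : finType) i (y : T) s b :
  (i <= size s)%N -> ins i y (rcons s b) = rcons (ins i y s) b.
Proof.
move=> si; rewrite /ins rcons_cat /= -drop_rcons //.
by rewrite -cats1 takel_cat.
Qed.

Section Pure.
Variables (n : nat) (g : sgraph n) (a b : 'I_n).
Implicit Types (s t : seq 'I_n).

(** The complex augmented by its empty simplex, as the reduced chains of [bd] require. *)
Definition ET0 L (s : seq 'I_n) :=
  uniq (a :: rcons s b) && leo (len g (a :: rcons s b)) L.

Lemma ET_ET0 L s : ET g L a b s = (s != [::]) && ET0 L s.
Proof. by []. Qed.

Lemma uniq_subseq_ends (s t : seq 'I_n) :
  subseq s t -> uniq (a :: rcons t b) -> uniq (a :: rcons s b).
Proof.
move=> st; apply: subseq_uniq; rewrite /= eqxx -!cats1.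
by rewrite cat_subseq ?subseq_refl.
Qed.

Lemma ET0_subseq L s t : subseq s t -> ET0 L t -> ET0 L s.
Proof.
move=> st /andP[ut lt]; apply/andP; split; first exact: uniq_subseq_ends ut.
exact: len_subseq lt.
Qed.

Lemma ET0_size L s : ET0 L s -> (size s < L)%N.
Proof. by case/andP=> us /(size_le_len us); rewrite size_rcons. Qed.

Variable l : nat.
Hypothesis common : forall (S : seq 'I_n) (u w : 'I_n),
  (size S <= l.+1)%N -> u != w ->
  exists y, [/\ y \notin S, adj g u y & adj g y w].

(** If some gap is not an edge, a common neighbour fits in at no cost. Otherwise the tuple is a path
    shorter than [L], and a detour replacing its first edge costs only one more. *)
Lemma ET0_extend L s : (L <= l)%N -> ((size s).+1 < L)%N -> ET0 L s ->
  exists i y, ET0 L (ins i y s).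
Proof.
move=> Ll sL /andP[us ls]; pose S := a :: rcons s b.
have com u w : u != w -> exists y, [/\ y \notin S, adj g u y & adj g y w].
  by apply: common; rewrite /= size_rcons; lia.
suff [i [y [si yS li]]] : exists i y,
    [/\ (i <= size s)%N, y \notin S & leo (len g (a :: ins i y (rcons s b))) L].
  exists i, y; rewrite /ET0 -ins_rcons // li andbT.
  move: yS us; rewrite /S inE negb_or /= mem_ins uniq_ins.
  by rewrite negb_or eq_sym => /andP[-> ->] /andP[-> ->].
have [ps|nps] := boolP (path (adj g) a (rcons s b)); last first.
  have [i [y [si yS li]]] := insert_nonadjacent com us ls nps.
  by exists i, y; rewrite size_rcons ltnS in si.
case sE: (rcons s b) ps us => [|x r] /=; first by case: (s) sE.
case/andP=> ax xr /andP[]; rewrite inE negb_or => /andP[nax _] _.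
have [y [yS ay yx]] := com _ _ nax; exists 0, y; split=> //.
rewrite /ins take0 drop0 /=.
apply: (@leo_trans _ (size [:: y, x & r])); last first.
  by apply: len_of_path; rewrite /= ay yx.
by rewrite /= -/(size (x :: r)) -sE size_rcons.
Qed.

Lemma ET0_facet L s : (L <= l)%N -> ET0 L s ->
  exists t, [/\ subseq s t, ET0 L t & (size t).+1 = L].
Proof.
move=> Ll; have [k] := ubnP (L - size s)%N.
elim: k s => // k IH s szk Xs; have sL := ET0_size Xs.
have [lt|ge] := ltnP (size s).+1 L; last first.
  by exists s; split=> //; apply/eqP; rewrite eqn_leq ge sL.
have [i [y Xi]] := ET0_extend Ll lt Xs.
have [|t [it Xt tL]] := IH _ _ Xi; first by rewrite size_ins subnS -ltnS prednK ?subn_gt0.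
by exists t; split=> //; apply: subseq_trans it; apply: subseq_ins.
Qed.

(** This is purity. The bound [1 < L] makes the extension of full size a nonempty tuple, hence a
    simplex. *)
Lemma facet_size L s : (1 < L <= l)%N -> facet (ET g L a b) s -> (size s).+1 = L.
Proof.
case/andP=> L1 Ll [+ smax]; rewrite ET_ET0 => /andP[s0 Xs].
have [t [st Xt tL]] := ET0_facet Ll Xs.
rewrite -(smax t) // ET_ET0 Xt andbT -size_eq0 -lt0n.
by move: L1; rewrite -tL.
Qed.

Lemma codim1_faceP (T : eqType) (r s : seq T) : uniq s -> codim1_face r s ->
  exists2 x, x \in s & r = seq.filter (predC1 x) s.
Proof.
move=> us /andP[rs /eqP sz].
have /allPn[x xs xr] : ~~ all (mem r) s.
  apply/negP=> /allP /(uniq_leq_size us); rewrite -sz; lia.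
exists x => //; have ur := subseq_uniq rs us.
have sub : subseq r (seq.filter (predC1 x) s).
  rewrite (subseq_uniqP us rs) subseq_filter filter_subseq andbT.
  apply/allP=> z; rewrite mem_filter => /andP[zr _] /=.
  by apply: contraNneq xr => <-.
apply/eqP; rewrite -(size_subseq_leqif sub) size_filter.
have := count_predC (pred1 x) s; rewrite count_uniq_mem // xs -sz add1n.
by case=> ->.
Qed.

(** By purity every facet has [L - 1] vertices and every simplex lies in a facet, so
    [shelling_acyclic] applies with that dimension. *)
Lemma shellable_acyclic L f : (1 < L <= l)%N -> shellable (ET g L a b) ->
    (forall s, f s != 0 -> ET0 L s /\ ((size s).+1 < L)%N) ->
    (forall s, bd f s = 0) ->
  exists h, (forall s, h s != 0 -> ET0 L s) /\ bd h =1 f.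
Proof.
move=> Ll [F [uF Ff shF]] fX f0; have [L1 Ll'] := andP Ll.
have XF s : has (subseq s) F = ET0 L s.
  apply/hasP/idP => [[t /Ff[+ _] st]|Xs].
    by rewrite ET_ET0 => /andP[_]; apply: ET0_subseq.
  have [t [st Xt tL]] := ET0_facet Ll' Xs; exists t => //; apply/Ff; split.
    by rewrite ET_ET0 Xt andbT; case: (t) tL L1 => //= <-.
  move=> r; rewrite ET_ET0 => /andP[_ /ET0_size szr] tr; apply/esym/eqP.
  by rewrite -(size_subseq_leqif tr) eqn_leq size_subseq // -ltnS tL.
have FX s : s \in F -> uniq s /\ size s = L.-1.
  move=> /Ff sF; rewrite -(facet_size Ll sF); split=> //.
  by case: sF; rewrite ET_ET0 => /and3P[_ /=/andP[_]]; rewrite rcons_uniq => /andP[].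
have [|||h [hX hf]] := @shelling_acyclic _ F L.-1 FX _ f; last 1 first.
- by exists h; split=> // s; rewrite -XF; exact: hX.
(* The first facet is attached along nothing, whence the empty [J]; later, [J] collects the vertices
   opposite to the attaching faces in [R]. *)
- case=> [_|k kF]; first by exists [::] => s _; rewrite take0.
  have [//|R [_ Rf RE]] := shF k.+1; have [uk _] := FX _ (mem_nth [::] kF).
  set Fk := nth [::] F k.+1 in Rf RE uk *.
  exists [seq x <- Fk | seq.filter (predC1 x) Fk \in R] => s sF.
  have := RE s; rewrite sF /= => ->; apply/hasP/hasP => [[r rR sr]|[x]].
    have [x xF rE] := codim1_faceP uk (Rf r rR).
    exists x; first by rewrite mem_filter -rE rR.
    apply/negP=> /(mem_subseq sr); rewrite rE mem_filter /= eqxx.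
    by [].
  rewrite mem_filter => /andP[xR xF] xs; exists (seq.filter (predC1 x) Fk) => //.
  rewrite subseq_filter sF andbT; apply/allP=> z zs /=.
  by apply: contraNneq xs => <-.
- by move=> s /fX[Xs sz]; rewrite XF Xs; split=> //; rewrite -ltnS prednK // ltnW.
- by [].
Qed.

End Pure.

(** * Eulerian magnitude chains *)

Lemma delE n k (i : 'I_k.+2) (x : k.+2.-tuple 'I_n) :
  del i x = take i x ++ drop i.+1 x :> seq 'I_n.
Proof.
have ik : (i <= k.+1)%N by rewrite -ltnS.
have sz : size (take i x) = i by rewrite size_takel // size_tuple ltnW.
apply: (@eq_from_nth _ (tnth x ord0)) => [|j].
  by rewrite size_tuple size_cat sz size_drop size_tuple subSS subnKC.
rewrite size_tuple => jk; rewrite (nth_mktuple _ _ (Ordinal jk)).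
rewrite (tnth_nth (tnth x ord0)) /= /bump nth_cat sz.
case: ltnP => [ji|ij]; first by rewrite nth_take.
by rewrite nth_drop addSn subnKC.
Qed.

(** Deletion is dual to insertion: only the deleted entry can contribute to the sum. This turns the
    differential, defined by deletions, into [bd]. *)
Lemma take_drop_eq (T : finType) i (t x : seq T) :
  (i <= size t)%N -> size x = (size t).+1 ->
  (take i x ++ drop i.+1 x == t :> seq T)%:R = \sum_(v : T) (x == ins i v t)%:R :> int.
Proof.
move=> it sx; have ix : (i < size x)%N by rewrite sx ltnS.
case: x => [|x0 x'] in sx ix *; first by [].
set x := x0 :: x' in sx ix *.
have xE : x = take i x ++ nth x0 x i :: drop i.+1 x.
  by rewrite -drop_nth // cat_take_drop.
have st : size (take i x) = size (take i t) by rewrite !size_takel // ltnW.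
have xI v : (x == ins i v t) =
    (v == nth x0 x i) && (take i x ++ drop i.+1 x == t).
  rewrite {1}xE -[in RHS](cat_take_drop i t) !eqseq_cat // eqseq_cons.
  by rewrite andbCA [nth _ _ _ == _]eq_sym.
rewrite (bigD1 (nth x0 x i)) //= xI eqxx big1 ?addr0 // => v vx.
by rewrite xI (negPf vx).
Qed.

Section Transport.
Variables (n : nat) (g : sgraph n) (l : nat) (a b : 'I_n).
Implicit Types (s t : seq 'I_n).

Lemma egenP k (x : egen g l a b k.+1) : exists s,
  [/\ tval (val x) = a :: rcons s b, size s = k, uniq (a :: rcons s b)
    & len g (a :: rcons s b) = Some l].
Proof.
case: x => x /= /and4P[/eqP xa /eqP xb ux /eqP lx].
case: (tupleP x) xa xb ux lx => y {}x; rewrite tnth0 => -> xb ux lx.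
move: xb; rewrite (tnth_nth a) /= => xb.
have {}ux : uniq (a :: tval x) by exact: ux.
have {}lx : len g (a :: tval x) = Some l by exact: lx.
suff : exists s, [/\ a :: tval x = a :: rcons s b, size s = k,
  uniq (a :: rcons s b) & len g (a :: rcons s b) = Some l] by [].
case: (lastP (tval x)) (size_tuple x) xb ux lx => // s z.
rewrite size_rcons => -[sx]; rewrite nth_rcons sx ltnn eqxx => ->.
by move=> us ls; exists s.
Qed.

Lemma egen_of k s : size s = k -> uniq (a :: rcons s b) ->
  len g (a :: rcons s b) = Some l ->
  exists x : egen g l a b k.+1, tval (val x) = a :: rcons s b.
Proof.
move=> sk us ls; have /eqP sz : size (a :: rcons s b) = k.+2.
  by rewrite /= size_rcons sk.
have Ex : eulerian g l a b (Tuple sz).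
  apply/and4P; split; [by rewrite (tnth_nth a) | | exact: us |exact/eqP].
  by rewrite (tnth_nth a) /= nth_rcons sk ltnn eqxx.
by exists (Sub (Tuple sz) Ex); rewrite SubK.
Qed.

(** The coefficient function of [z] on tuples of interior vertices, extended by zero; the sum has at
    most one term. *)
Definition chain k (z : EMC g l a b k.+1) s : int :=
  \sum_(x : egen g l a b k.+1 | tval (val x) == a :: rcons s b) z x.

Lemma chain_egen k (z : EMC g l a b k.+1) x s :
  tval (val x) = a :: rcons s b -> chain z s = z x.
Proof.
move=> xE; rewrite /chain (bigD1 x) ?xE ?eqxx //= big1 ?addr0 // => y.
case/andP=> /eqP yE /eqP[]; apply: val_inj; apply: val_inj.
by rewrite /= yE -xE.
Qed.

Lemma chain_neq0 k (z : EMC g l a b k.+1) s : chain z s != 0 ->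
  [/\ size s = k, uniq (a :: rcons s b) & len g (a :: rcons s b) = Some l].
Proof.
move=> zs; have [x /eqP xE] : exists x : egen g l a b k.+1,
    tval (val x) == a :: rcons s b.
  apply/existsP; apply: contraNT zs => /existsPn sx.
  by rewrite /chain big1 // => x; rewrite (negPf (sx x)).
have [t [tE sk us ls]] := egenP x.
move: tE; rewrite xE => -[]/eqP; rewrite eqseq_rcons eqxx andbT => /eqP ->.
by [].
Qed.

Lemma bdry_iE k i (x : egen g l a b k.+1) y :
  bdry_i i x y = (del i (val x) == val y)%:R.
Proof.
rewrite /bdry_i; case: insubP => [y' _ <-|nE]; rewrite ffunE.
  by rewrite (inj_eq val_inj) eq_sym.
by case: eqP => // xy; rewrite xy (valP y) in nE.
Qed.

(** The interior vertex of index [i] has position [i + 1] in the full tuple, which accounts for the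
    sign. *)
Lemma bdryS_chain k (z : EMC g l a b k.+2) (y : egen g l a b k.+1) s :
  tval (val y) = a :: rcons s b -> bdryS z y = - bd (chain z) s.
Proof.
move=> yE; have [t [tE sk _ _]] := egenP y.
move: tE; rewrite yE => -[]/eqP; rewrite eqseq_rcons eqxx andbT => /eqP ts.
rewrite -{t}ts in sk.
have sumE x : (\sum_(i < k.+3 | (0 < i < k.+2)%N)
      bdry_i i x *~ (-1) ^+ i : EMC g l a b k.+1) y =
    - \sum_(i < k.+1) \sum_v (-1) ^+ i *
      (tval (val x) == a :: rcons (ins i v s) b)%:R.
  rewrite sum_ffunE big_mkcond big_ord_recl /= add0r big_ord_recr /=.
  rewrite /bump /= add1n ltnn addr0 -sumrN; apply: eq_bigr => i _.
  rewrite !add1n ltnS ltn_ord ffunMzE bdry_iE -val_eqE /= delE yE.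
  rewrite !lift0 take_drop_eq; first last.
  - by rewrite size_tuple /= size_rcons sk.
  - by rewrite /= size_rcons sk ltnS; apply: ltnW; exact: ltn_ord.
  rewrite -mulrzr intz mulr_suml -sumrN exprS; apply: eq_bigr => v _.
  by rewrite mulN1r mulrN mulrC -ins_rcons // sk -ltnS; exact: ltn_ord.
rewrite /bdryS sum_ffunE /bd sk.
under eq_bigr => x _ do rewrite ffunMzE sumE mulNrz -mulrzr intz mulr_suml.
rewrite sumrN exchange_big; congr (- _); apply: eq_bigr => i _ /=.
under eq_bigr => x _ do rewrite mulr_suml.
rewrite exchange_big; apply: eq_bigr => v _ /=.
rewrite /chain mulr_sumr [RHS]big_mkcond; apply: eq_bigr => x _ /=.
by case: eqP => _; rewrite ?mulr1 ?mulr0 ?mul0r.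
Qed.

End Transport.

(** * Torsion-freeness for graphs with many common neighbours *)

Section TorsionFree.
Variables (n : nat) (g : sgraph n) (l : nat) (a b : 'I_n).
Implicit Types (s t : seq 'I_n).

Lemma egen_bound k : egen g l a b k -> (k <= l)%N.
Proof.
case: k => // k x; have [s [_ <- us ls]] := egenP x.
by have := @size_le_len _ g _ _ l us; rewrite ls /= size_rcons; apply.
Qed.

Lemma egen0_false : (0 < l)%N -> egen g l a b 0 -> False.
Proof.
move=> l0 [x /and4P[_ _ _ /eqP]].
case: (tupleP x) => y {}x; rewrite (tuple0 x) /len /= => -[] l0'.
by rewrite -l0' in l0.
Qed.

Lemma egen_dist k : (0 < l)%N -> egen g l a b k -> leo (dist g a b) l.
Proof.
case: k => [|k] l0 x; first by case: (egen0_false l0 x).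
have [s [_ _ us ls]] := egenP x.
have := @len_subseq _ g a b [::] s l (sub0seq s).
rewrite ls /= leqnn => /(_ isT); rewrite /len /=.
by case: (dist g a b) => //= d; rewrite addn0.
Qed.

Lemma egen_neq k : (0 < l)%N -> egen g l a b k -> a != b.
Proof.
case: k => [|k] l0 x; first by case: (egen0_false l0 x).
have [s [_ _ + _]] := egenP x.
by rewrite /= mem_rcons inE negb_or => /andP[/andP[]].
Qed.

(** The differential of [EMC] sees only faces of length exactly [l]; on shorter faces [bd] of a
    cycle may survive. *)
Lemma bd_chain_cycle k (z : EMC g l a b k.+1) s : bdry z = 0 ->
  (size s).+1 = k -> uniq (a :: rcons s b) ->
  len g (a :: rcons s b) = Some l -> bd (chain z) s = 0.
Proof.
case: k z => // k z z0 [sk] us ls; have [y yE] := egen_of sk us ls.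
by apply: oppr_inj; rewrite oppr0 -(bdryS_chain z yE) -/(bdry z) z0 ffunE.
Qed.

Lemma len_exact s L : (0 < L)%N -> leo (len g s) L -> ~~ leo (len g s) L.-1 ->
  len g s = Some L.
Proof. by case: (len g s) => //= m L0 mL; rewrite -ltnNge => ?; congr Some; lia. Qed.

(** In degrees [k >= l] there are no generators one degree up. Below, the long exact sequence of the
    pair of complexes is run by hand: [bd] of the cycle lives in the smaller complex and is filled
    there by [w]; the cycle minus [w] is then closed in the larger complex and is filled by [u],
    whose part of length [l] is the bounding chain. *)
Lemma torsion_free_of_common : (3 <= l)%N ->
    (forall (S : seq 'I_n) (u w : 'I_n), (size S <= l.+1)%N -> u != w ->
      exists y, [/\ y \notin S, adj g u y & adj g y w]) ->
    shellable (ET g l a b) -> shellable (ET g l.-1 a b) ->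
  forall k, torsion_free (EMH g l a b k).
Proof.
move=> l3 common shl shl1 k; have l0 : (0 < l)%N by exact: leq_trans l3.
have [kl|lk] := ltnP k l; last first.
  by apply: torsion_free_EMH_egenS0 => /egen_bound; rewrite ltnNge lk.
case: k kl => [|k] kl.
  exact: torsion_free_EMH_egen0 (egen0_false l0).
apply: torsion_free_EMH => z _ _ z0 _.
have fX s : chain z s != 0 -> ET0 g a b l s /\ size s = k.
  by case/chain_neq0=> sk us ls; rewrite /ET0 us ls /= leqnn.
have dfX s : bd (chain z) s != 0 -> ET0 g a b l.-1 s /\ ((size s).+1 < l.-1)%N.
  move=> ds; have [i [v /fX[Xi sk]]] := bd_neq0 ds.
  rewrite size_ins in sk.
  have Xs : ET0 g a b l s by apply: ET0_subseq Xi; apply: subseq_ins.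
  split; last by rewrite sk -subn1 ltn_subRL add1n.
  have /andP[us ls] := Xs; rewrite /ET0 us /=; apply: contraNT ds => nls.
  by apply/eqP/bd_chain_cycle => //; apply: len_exact.
have l1 : (1 < l.-1 <= l)%N by lia.
have [w [wX wE]] := shellable_acyclic common l1 shl1 dfX (bd_bd _).
have [|||u [uX uE]] :=
  @shellable_acyclic _ g a b l common l (fun s => chain z s - w s) _ shl.
- by rewrite leqnn andbT; lia.
- move=> s; have [fs|/fX[Xs sk] _] := eqVneq (chain z s) 0; last first.
    by split=> //; rewrite sk.
  rewrite fs sub0r oppr_eq0 => /wX Xs; split; last first.
    by have := ET0_size Xs; lia.
  by case/andP: Xs => us ls; rewrite /ET0 us; apply: leo_trans ls; lia.
- by move=> s; rewrite bdB wE subrr.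
(* The sign compensates the one between [bdryS] and [bd]; [behead] and [take] strip the endpoints
   from the generator. *)
exists [ffun x => - u (take k.+1 (behead (tval (val x))))].
apply/ffunP=> y; have [s [yE sk us ls]] := egenP y.
rewrite /= (bdryS_chain _ yE); apply: oppr_inj; rewrite opprK.
have ws : w s = 0.
  by apply/eqP/contraT => /wX/andP[_]; rewrite ls /=; lia.
have <- : chain z s = z y by exact: chain_egen.
have <- : - bd u s = - chain z s by rewrite uE ws subr0.
rewrite /bd -sumrN; apply: eq_bigr => i _; rewrite -sumrN; apply: eq_bigr => v _.
rewrite -mulrN; congr (_ * _).
set t := ins i v s; have szt : size t = k.+1 by rewrite size_ins sk.
(* An extension of [s] in the support of [u] has length at most [l], and at least that of [s], which
   is [l]; so it is a generator. *)
have [ut|/uX/andP[ut lt]] := eqVneq (u t) 0.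
  rewrite ut oppr0; set c := chain _.
  have [//|/chain_neq0[_ ut' lt']] := eqVneq (c t) 0.
  have [x xE] := egen_of szt ut' lt'.
  by rewrite /c (chain_egen _ xE) ffunE xE /= -cats1 take_size_cat // ut oppr0.
have lt' : len g (a :: rcons t b) = Some l.
  apply: len_exact => //; apply/negP=> /(len_subseq (subseq_ins i v s)).
  by rewrite ls /=; lia.
have [x xE] := egen_of szt ut lt'.
by rewrite (chain_egen _ xE) ffunE xE /= -cats1 take_size_cat.
Qed.

End TorsionFree.

(** * Random subsets of a finite set *)

Section RandomSubset.
Variables (R : realType) (I : finType) (q : I -> R).
Hypothesis q01 : forall i, 0 <= q i <= 1.
Implicit Types (J B : {set I}) (f h : {set I} -> R) (P Q : pred {set I}).

Definition weight J : R := \prod_i (if i \in J then q i else 1 - q i).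
Definition Ex f : R := \sum_(J : {set I}) weight J * f J.
Definition Pr P : R := Ex (fun J => (P J)%:R).

Lemma weight_ge0 J : 0 <= weight J.
Proof.
by apply: prodr_ge0 => i _; have /andP[q0 q1] := q01 i; case: ifP; rewrite ?subr_ge0.
Qed.

Lemma le_Ex f h : (forall J, f J <= h J) -> Ex f <= Ex h.
Proof. by move=> fh; apply: ler_sum => J _; rewrite ler_wpM2l ?weight_ge0. Qed.

Lemma Ex_sum (T : Type) (r : seq T) (F : T -> {set I} -> R) (P : pred T) :
  Ex (fun J => \sum_(t <- r | P t) F t J) = \sum_(t <- r | P t) Ex (F t).
Proof.
rewrite /Ex exchange_big /=; apply: eq_bigr => J _.
by rewrite mulr_sumr.
Qed.

Lemma ExZ c f : Ex (fun J => c * f J) = c * Ex f.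
Proof. by rewrite /Ex mulr_sumr; apply: eq_bigr => J _; rewrite mulrCA. Qed.

Lemma ExB f h : Ex (fun J => f J - h J) = Ex f - Ex h.
Proof. by rewrite /Ex -sumrB; apply: eq_bigr => J _; rewrite mulrBr. Qed.

Lemma Ex_prod (F G : I -> R) :
  Ex (fun J => \prod_i (if i \in J then F i else G i)) =
  \prod_i (q i * F i + (1 - q i) * G i).
Proof.
rewrite bigA_distr; apply: eq_bigr => J _; rewrite -big_split.
by apply: eq_bigr => i _; case: ifP.
Qed.

Lemma Ex1 : Ex (fun=> 1) = 1.
Proof.
transitivity (Ex (fun J => \prod_i (if i \in J then 1 else 1))).
  by apply: eq_bigr => J _; congr (_ * _); rewrite big1 // => i _; case: ifP.
by rewrite Ex_prod big1 // => i _; rewrite !mulr1 addrC subrK.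
Qed.

Lemma Pr_le1 P : Pr P <= 1.
Proof. by rewrite -Ex1; apply: le_Ex => J; rewrite lern1; case: (P J). Qed.

Lemma le_Pr P Q : (forall J, P J -> Q J) -> Pr P <= Pr Q.
Proof.
move=> PQ; apply: le_Ex => J; rewrite ler_nat.
by case PJ: (P J); rewrite // (PQ J PJ).
Qed.

Lemma eq_Pr P Q : P =1 Q -> Pr P = Pr Q.
Proof. by move=> PQ; apply: eq_bigr => J _; rewrite PQ. Qed.

Lemma PrC P : Pr (fun J => ~~ P J) = 1 - Pr P.
Proof.
rewrite -Ex1 -ExB; apply: eq_bigr => J _; case: (P J); rewrite /= ?subrr ?subr0 //.
Qed.

Lemma Pr_union (T : finType) (S : pred T) (E : T -> pred {set I}) :
  Pr (fun J => [exists t, S t && E t J]) <= \sum_(t | S t) Pr (E t).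
Proof.
rewrite -Ex_sum; apply: le_Ex => J.
case: (boolP [exists t, _]) => [/existsP[t /andP[St EJ]]|_] /=; last first.
  by apply: sumr_ge0 => t _; rewrite ler0n.
by rewrite (bigD1 t) //= EJ lerDl sumr_ge0 // => s _; rewrite ler0n.
Qed.

Lemma Pr_cyl (A D : {set I}) : [disjoint A & D] ->
  Pr (fun J => (A \subset J) && [disjoint D & J]) =
  \prod_(i in A) q i * \prod_(i in D) (1 - q i).
Proof.
(* [F] kills the sets meeting [D] and [G] those missing an element of [A], so their product is the
   indicator of the event. *)
move=> AD; pose F i : R := if i \in D then 0 else 1.
pose G i : R := if i \in A then 0 else 1.
have := Ex_prod F G; rewrite [X in _ = X -> _](_ : _ =
  \prod_(i in A) q i * \prod_(i in D) (1 - q i)).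
  move=> <-; apply: eq_bigr => J _; congr (_ * _).
  case: (boolP (_ && _)) => [/andP[/subsetP AJ DJ]|].
    rewrite big1 // => i _; rewrite /F /G; case: (boolP (i \in J)) => iJ.
      by rewrite (disjointFl DJ iJ).
    by case: ifPn => // /AJ; rewrite (negPf iJ).
  rewrite negb_and => /orP[/subsetPn[i iA iJ]|].
    by rewrite (bigD1 i) //= /G iA (negPf iJ) mul0r.
  rewrite disjoint_subset => /subsetPn[i iD]; rewrite !inE negbK => iJ.
  by rewrite (bigD1 i) //= /F iD iJ mul0r.
rewrite (big_mkcond (fun i => i \in A)) (big_mkcond (fun i => i \in D)) -big_split.
apply: eq_bigr => i _; rewrite /F /G /=.
case: (boolP (i \in A)) => iA.
  by rewrite (disjointFr AD iA) mulr0 addr0.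
by case: (i \in D); rewrite ?mulr0 ?add0r ?mulr1 ?mul1r // addrC subrK.
Qed.

Lemma Pr_sub (A : {set I}) : Pr (fun J => A \subset J) = \prod_(i in A) q i.
Proof.
have A0 : [disjoint A & (set0 : {set I})] by rewrite disjoints_subset setC0 subsetT.
have := Pr_cyl A0; rewrite big_set0 mulr1 => <-; apply: eq_Pr => J.
by rewrite disjoints_subset sub0set andbT.
Qed.

(** The weight splits into a factor on [B] and one off [B], so the left side is a product of two
    partial sums. The total masses of the two factors multiply to one, which turns the partial sums
    into expectations. *)
Lemma Ex_indep B f h :
  (forall J, f J = f (J :&: B)) -> (forall J, h J = h (J :\: B)) ->
  Ex (fun J => f J * h J) = Ex f * Ex h.
Proof.
move=> fB hB.
pose wB J : R := \prod_(i in B) (if i \in J then q i else 1 - q i).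
pose wC J : R := \prod_(i | i \notin B) (if i \in J then q i else 1 - q i).
have wE J : weight J = wB J * wC J by exact: bigID.
have wBI J : wB J = wB (J :&: B).
  by apply: eq_bigr => i iB; rewrite inE iB andbT.
have wCD J : wC J = wC (J :\: B).
  by apply: eq_bigr => i iB; rewrite inE iB.
have factor f' h' : (forall J, f' J = f' (J :&: B)) ->
    (forall J, h' J = h' (J :\: B)) -> Ex (fun J => f' J * h' J) =
    (\sum_(J : {set I} | J \subset B) wB J * f' J) *
    (\sum_(J : {set I} | J \subset ~: B) wC J * h' J).
  move=> f'B h'B; rewrite /Ex (partition_big (fun J : {set I} => J :&: B)
    (fun J : {set I} => J \subset B)) /=.
    rewrite mulr_suml; apply: eq_bigr => J1 J1B.
    rewrite mulr_sumr (reindex_onto (fun J2 : {set I} => J1 :|: J2)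
      (fun J : {set I} => J :\: B)) /=.
      apply: eq_big => [J2|J2].
        apply/andP/idP => [[_ /eqP <-]|J2B]; first exact: subsetDr.
        have /eqP J20 : J2 :&: B == set0 by rewrite setI_eq0 disjoints_subset.
        rewrite setIUl (setIidPl J1B) J20 setU0 eqxx setDUl.
        have /eqP -> : J1 :\: B == set0 by rewrite setD_eq0.
        by rewrite set0U setDE (setIidPl J2B).
      case/andP=> /eqP J1E /eqP J2E.
      rewrite wE wBI J1E wCD J2E f'B J1E h'B J2E; ring.
    move=> J /eqP <-; by rewrite setID.
  by move=> J _; rewrite subsetIr.
have all1 (F : {set I} -> R) : Ex F = Ex (fun J => F J * 1).
  by apply: eq_bigr => J _; rewrite mulr1.
have all1' (F : {set I} -> R) : Ex F = Ex (fun J => 1 * F J).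
  by apply: eq_bigr => J _; rewrite mul1r.
have := factor (fun=> 1) (fun=> 1) (fun=> erefl) (fun=> erefl).
rewrite -all1 Ex1 => one.
have unit_factor (x y u v : R) : 1 = u * y -> x * v = x * y * (u * v).
  by move=> uy; rewrite -[LHS]mulr1 uy; ring.
rewrite (all1 f) (all1' h) !factor //; exact: unit_factor one.
Qed.

(** Events determined by disjoint sets of coordinates are independent; one event is split off at a
    time. *)
Lemma Pr_all (Y : finType) (B : Y -> {set I}) (E : Y -> pred {set I}) (D : {set Y})
    (B0 : {set I}) (E0 : pred {set I}) :
  (forall y z, y \in D -> z \in D -> y != z -> [disjoint B y & B z]) ->
  (forall y, y \in D -> [disjoint B0 & B y]) ->
  (forall J, E0 J = E0 (J :&: B0)) ->
  (forall y J, y \in D -> E y J = E y (J :&: B y)) ->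
  Pr (fun J => E0 J && [forall y in D, E y J]) = Pr E0 * \prod_(y in D) Pr (E y).
Proof.
move=> Bdisj B0disj E0B EB.
have [k] := ubnP #|D|; elim: k D Bdisj B0disj EB => // k IH D Bdisj B0disj EB Dk.
have [->|[y yD]] := set_0Vmem D.
  rewrite big_set0 mulr1; apply: eq_Pr => J.
  by rewrite (_ : [forall y in _, _]) ?andbT //; apply/forall_inP=> y; rewrite inE.
have Dy : D :\ y \subset D by exact: subsetDl.
have DyE : \prod_(z in D) Pr (E z) = Pr (E y) * \prod_(z in D :\ y) Pr (E z).
  by rewrite (big_setD1 y).
rewrite DyE mulrCA -IH; first last.
- by move: Dk; rewrite (cardsD1 y D) yD.
- by move=> z J /(subsetP Dy); apply: EB.
- by move=> z /(subsetP Dy); apply: B0disj.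
- by move=> z t /(subsetP Dy) zD /(subsetP Dy) tD; apply: Bdisj.
rewrite -(@Ex_indep (B y)) => [|J|J].
- apply: eq_bigr => J _; rewrite -natrM mulnb; congr (_ * (nat_of_bool _)%:R).
  rewrite andbCA; congr (_ && _); apply/forall_inP/andP => [DJ|[yJ /forall_inP DJ] z zD].
    by split; [apply: DJ|apply/forall_inP=> z /(subsetP Dy); apply: DJ].
  by have [->//|zy] := eqVneq z y; apply: DJ; rewrite !inE zy.
- by rewrite EB.
have keep (C : {set I}) : [disjoint C & B y] -> (J :\: B y) :&: C = J :&: C.
  move=> CB; apply/setP=> i; rewrite !inE.
  by case: (boolP (i \in C)) => iC; rewrite ?andbF // (disjointFr CB iC).
congr (nat_of_bool (_ && _))%:R.
  by rewrite E0B [RHS]E0B keep // B0disj.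
apply: eq_forallb => z; case: (boolP (z \in D :\ y)) => //= zDy.
have zD := subsetP Dy z zDy; rewrite (EB z J) // [RHS](EB z) // keep // Bdisj //.
by move: zDy; rewrite !inE => /andP[].
Qed.

End RandomSubset.

(** * Random graphs *)

Section EdgeProbability.
Variables (R : realType) (n : nat) (p : R).
Hypothesis p01 : 0 <= p <= 1.
Implicit Types (u v w y : 'I_n) (J A : {set {set 'I_n}}) (e : {set 'I_n}).

(** Sets that are not pairs get probability zero, so that a random graph is a random subset of all
    vertex sets. *)
Definition edge_prob e : R := if #|e| == 2%N then p else 0.

Lemma edge_prob01 e : 0 <= edge_prob e <= 1.
Proof. by rewrite /edge_prob; case: ifP; rewrite ?lexx ?ler01. Qed.

Lemma gnp_PrE (P : sgraph n -> Prop) : gnp_prob p P =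
  Pr edge_prob (fun J => [exists g : sgraph n, (val g == J) && `[< P g >]]).
Proof.
rewrite /gnp_prob /Pr /Ex.
pose valid J := [forall e in J, #|e| == 2%N].
rewrite [RHS](bigID valid) /= [X in _ = _ + X]big1 ?addr0; last first.
  move=> J; rewrite negb_forall_in => /existsP[e /andP[eJ e2]].
  by rewrite /weight (bigD1 e) //= eJ /edge_prob (negPf e2) !mul0r.
rewrite (reindex_omap (val : sgraph n -> {set {set 'I_n}}) insub) /=; last first.
  by move=> J vJ; rewrite insubT.
rewrite big_mkcond [RHS]big_mkcond; apply: eq_bigr => g _.
have vg : valid (val g) by exact: (valP g).
have gE : [exists h : sgraph n, (val h == val g) && `[< P h >]] = `[< P g >].
  apply/existsP/idP => [[h /andP[/eqP/val_inj -> //]]|Pg].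
  by exists g; rewrite eqxx.
rewrite vg /= valK eqxx gE; case: asboolP => _; rewrite ?mulr0 // mulr1.
rewrite /weight [RHS](bigID (fun e => #|e| == 2%N)) /= [X in _ = _ * X]big1 ?mulr1.
  by apply: eq_bigr => e e2; rewrite /edge_prob e2.
move=> e e2; rewrite /edge_prob (negPf e2) subr0; case: ifP => // eg.
by move/forall_inP: vg => /(_ e eg); rewrite (negPf e2).
Qed.

Lemma gnp_le (P Q : sgraph n -> Prop) :
  (forall g, P g -> Q g) -> gnp_prob p P <= gnp_prob p Q.
Proof.
move=> PQ; rewrite !gnp_PrE; apply: le_Pr edge_prob01 _ _ _ => J.
case/existsP=> g /andP[gJ /asboolP/PQ Qg]; apply/existsP; exists g.
by rewrite gJ; apply/asboolP.
Qed.

Lemma gnp_PrP (P : pred {set {set 'I_n}}) :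
  gnp_prob p (fun g => P (val g)) = Pr edge_prob P.
Proof.
rewrite gnp_PrE; apply: eq_bigr => J _.
have [/forall_inP vJ|] := boolP [forall e in J, #|e| == 2%N].
  congr (_ * (nat_of_bool _)%:R).
  apply/existsP/idP => [[g /andP[/eqP <- /asboolP//]]|PJ].
  have vJ' : [forall e in J, #|e| == 2%N] by apply/forall_inP.
  by exists (Sub J vJ'); rewrite SubK eqxx; apply/asboolP.
rewrite negb_forall_in => /existsP[e /andP[eJ e2]].
by rewrite /weight (bigD1 e) //= eJ /edge_prob (negPf e2) !mul0r.
Qed.

Lemma gnp_le1 (P : sgraph n -> Prop) : gnp_prob p P <= 1.
Proof. by rewrite gnp_PrE Pr_le1 //; exact: edge_prob01. Qed.

Definition gweight (g : sgraph n) : R :=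
  \prod_(e : {set 'I_n} | #|e| == 2%N) (if e \in val g then p else 1 - p).

Lemma gweight_ge0 g : 0 <= gweight g.
Proof.
by have /andP[p0 p1] := p01; apply: prodr_ge0 => e _; case: ifP; rewrite ?subr_ge0.
Qed.

Lemma gnp_probE (P : sgraph n -> Prop) :
  gnp_prob p P = \sum_g gweight g * `[< P g >]%:R.
Proof.
rewrite /gnp_prob big_mkcond; apply: eq_bigr => g _.
by case: asboolP => _; rewrite ?mulr1 ?mulr0.
Qed.

Lemma sum_gweight : \sum_g gweight g = 1.
Proof.
have := gnp_PrP predT; rewrite (_ : Pr edge_prob predT = 1); last exact: Ex1.
move=> <-; rewrite gnp_probE; apply: eq_bigr => g _.
by rewrite asboolT // mulr1.
Qed.

Lemma gnp_not (P : sgraph n -> Prop) :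
  gnp_prob p (fun g => ~ P g) = 1 - gnp_prob p P.
Proof.
rewrite -sum_gweight !gnp_probE -sumrB; apply: eq_bigr => g _.
by rewrite asbool_neg; case: asboolP => _; rewrite ?mulr1 ?mulr0 ?subrr ?subr0.
Qed.

Lemma gnp_and (P Q : sgraph n -> Prop) :
  gnp_prob p P + gnp_prob p Q - 1 <= gnp_prob p (fun g => P g /\ Q g).
Proof.
rewrite -sum_gweight !gnp_probE -big_split -sumrB; apply: ler_sum => g _ /=.
have w0 := gweight_ge0 g; rewrite asbool_and.
by case: asboolP => _; case: asboolP => _; rewrite /= ?mulr1 ?mulr0; lra.
Qed.

Lemma Pr_edges A : (forall e, e \in A -> #|e| = 2%N) ->
  Pr edge_prob (fun J => A \subset J) = p ^+ #|A|.
Proof.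
move=> A2; rewrite Pr_sub -prodr_const; apply: eq_bigr => e /A2 e2.
by rewrite /edge_prob e2.
Qed.

(** * First moment bounds for short paths and for missing common neighbours *)

Definition path_edges u (s : seq 'I_n) : {set {set 'I_n}} :=
  [set e in pairmap (fun x y => [set x; y]) u s].

Lemma path_edges_subset (g : sgraph n) u s :
  path (adj g) u s = (path_edges u s \subset val g).
Proof.
have -> : path (adj g) u s = all (mem (val g)) (pairmap (fun x y => [set x; y]) u s).
  by elim: s u => //= x s IH u; rewrite IH.
apply/allP/subsetP => H e; first by rewrite inE => /H.
by move=> es; apply: H; rewrite inE.
Qed.

(** The first vertex of the path lies on no later edge, so the edges are distinct. *)
Lemma card_path_edges u s : uniq (u :: s) ->
  #|path_edges u s| = size s /\ forall e, e \in path_edges u s -> #|e| = 2%N.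
Proof.
move=> us; set r := pairmap (fun x y => [set x; y]) u s.
have [ur r2] : uniq r /\ forall e, e \in r -> #|e| = 2%N.
  rewrite {}/r; elim: s u us => //= x s IH u /andP[]; rewrite inE negb_or.
  case/andP=> ux us /IH[-> r2]; split; last first.
    by move=> e; rewrite inE => /orP[/eqP ->|/r2//]; rewrite cards2 ux.
  rewrite andbT; apply/negP => uxr.
  have {r2} sub : forall e, e \in pairmap (fun x y => [set x; y]) x s ->
      e \subset x :: s.
    elim: s x {IH us ux uxr r2} => //= y s IH x e.
    rewrite inE => /orP[/eqP ->|/IH es].
      by apply/subsetP=> z; rewrite !inE => /orP[] ->; rewrite ?orbT.
    apply: (fintype.subset_trans es); apply/subsetP=> z.
    by rewrite !inE => ->; rewrite orbT.
  have := subsetP (sub _ uxr) u; rewrite !inE eqxx /= => /(_ isT).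
  by rewrite (negPf ux) (negPf us).
split=> [|e]; last by rewrite inE; exact: r2.
rewrite /path_edges -/r cardsE; have /card_uniqP -> := ur.
by rewrite size_pairmap.
Qed.

(** A short walk contains a path without repetition; the term [j] is the union bound over paths with
    [j] interior vertices. *)
Lemma gnp_dist_bound l u v : u != v ->
  gnp_prob p (fun g => leo (dist g u v) l) <= \sum_(j < l) n%:R ^+ j * p ^+ j.+1.
Proof.
move=> uv.
pose E (t : {j : 'I_l & j.-tuple 'I_n}) J :=
  uniq (u :: rcons (tagged t) v) && (path_edges u (rcons (tagged t) v) \subset J).
apply: (@le_trans _ _ (Pr edge_prob (fun J => [exists t, E t J]))).
  rewrite -gnp_PrP; apply: gnp_le => g /dist_leP[m ml /walkP[s [us ls sm]]].
  case/shortenP: us ls => s' us' uqs' sub ls.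
  have ss : (size s' <= size s)%N by apply: uniq_leq_size sub; case/andP: uqs'.
  case: (lastP s') us' uqs' ss ls => [|t z] us' uqs' ss ls.
    by rewrite /= in ls; rewrite ls eqxx in uv.
  rewrite last_rcons in ls; rewrite {z}ls in us' uqs' ss.
  rewrite size_rcons in ss.
  have tl : (size t < l)%N by rewrite (leq_trans ss) // sm.
  apply/existsP; exists (Tagged (fun j : 'I_l => j.-tuple 'I_n)
    (in_tuple t : (Ordinal tl).-tuple 'I_n)).
  by rewrite /E [uniq _]uqs' -path_edges_subset.
apply: (le_trans (Pr_union edge_prob01 predT _)).
have -> : \sum_(j < l) n%:R ^+ j * p ^+ j.+1 =
    \sum_(j < l) \sum_(t : j.-tuple 'I_n) p ^+ j.+1.
  apply: eq_bigr => j _; rewrite sumr_const card_tuple card_ord.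
  by rewrite -[in RHS]mulr_natl natrX.
rewrite [leRHS]sig_big_dep; apply: ler_sum => -[j t] _ /=.
have [uq|nuq] := boolP (uniq (u :: rcons t v)); last first.
  rewrite /Pr /Ex big1 ?exprn_ge0 //; first by case/andP: p01.
  move=> J _; rewrite [X in nat_of_bool X](_ : _ = false) ?mulr0 //.
  by apply/negbTE; apply: contra nuq => /andP[].
have [sz e2] := card_path_edges uq.
have <- : Pr edge_prob (fun J => path_edges u (rcons t v) \subset J) = p ^+ j.+1.
  by rewrite Pr_edges // sz size_rcons size_tuple.
by apply: le_Pr => [|J /andP[]//]; exact: edge_prob01.
Qed.

(** There are [n ^ (c + 2)] choices of [S], [u], [w]. For each of them, the at least [n - (c + 2)]
    remaining vertices fail independently, with probability [1 - p ^ 2] each, as their pairs of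
    edges are disjoint. *)
Lemma gnp_common_bound c :
  gnp_prob p (fun g => ~ forall (S : seq 'I_n) u w, (size S <= c)%N -> u != w ->
     exists y, [/\ y \notin S, adj g u y & adj g y w]) <=
  n%:R ^+ c.+2 * (1 - p ^+ 2) ^+ (n - c.+2).
Proof.
have /andP[p0 p1] := p01.
have p2 : 0 <= 1 - p ^+ 2 by rewrite subr_ge0 expr_le1.
pose V := (c.-tuple 'I_n * ('I_n * 'I_n))%type.
pose D (t : V) := ~: [set y | y \in [:: t.2.1, t.2.2 & tval t.1]].
pose E (t : V) J := [forall y in D t,
  ~~ ([set [set t.2.1; y]; [set y; t.2.2]] \subset J)].
apply: (@le_trans _ _ (Pr edge_prob (fun J => [exists t, (t.2.1 != t.2.2) && E t J]))).
  rewrite -gnp_PrP; apply: gnp_le => g; apply: contra_notP => /negP.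
  rewrite negb_exists => /forallP H S u w Sc uw.
  (* Shorter lists are padded with copies of [u], so that the union bound runs over tuples of length
     exactly [c]. *)
  have Sz : size (take c (S ++ nseq c u)) == c.
    by rewrite size_takel // size_cat size_nseq leq_addl.
  have Ssub : {subset S <= take c (S ++ nseq c u)}.
    by move=> y yS; rewrite take_cat ltnNge Sc mem_cat yS.
  have := H (Tuple Sz, (u, w)); rewrite /= uw negb_forall_in => /existsP[y].
  rewrite negbK !inE !negb_or => /andP[/and3P[yu yw yS] yE].
  exists y; split.
  - by apply: contra yS => /Ssub.
  - by apply: (subsetP yE); rewrite !inE eqxx.
  - by apply: (subsetP yE); rewrite !inE eqxx orbT.
apply: (le_trans (Pr_union edge_prob01 (fun t : V => t.2.1 != t.2.2) _)).
apply: (@le_trans _ _ (\sum_(t : V) (1 - p ^+ 2) ^+ (n - c.+2))); last first.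
  rewrite sumr_const !card_prod card_tuple !card_ord -[leLHS]mulr_natl.
  by rewrite -natrX !expnS [(n ^ c * _)%N]mulnC mulnA.
rewrite big_mkcond /=; apply: ler_sum => -[S [u w]] _ /=.
case: ifPn => uw; last by rewrite exprn_ge0.
pose B y : {set {set 'I_n}} := [set [set u; y]; [set y; w]].
have Bdisj y z : y \in D (S, (u, w)) -> z \in D (S, (u, w)) ->
    y != z -> [disjoint B y & B z].
  rewrite !inE /= !negb_or => /and3P[yu yw _] /and3P[zu zw _] yz.
  rewrite -setI_eq0; apply/eqP/setP => e; rewrite !inE; apply/negP.
  case/andP=> /orP[]/eqP -> /orP[]/eqP/setP /(_ y);
  by rewrite !inE eqxx ?orbT /= ?(negPf yu) ?(negPf yz) ?(negPf yw).
have EP : Pr edge_prob (E (S, (u, w))) =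
    \prod_(y in D (S, (u, w))) Pr edge_prob (fun J => ~~ (B y \subset J)).
  have := @Pr_all _ _ edge_prob _ B (fun y J => ~~ (B y \subset J))
    (D (S, (u, w))) set0 predT Bdisj.
  rewrite (_ : Pr edge_prob predT = 1); last exact: Ex1.
  rewrite mul1r; apply=> // [y _|y J _]; first by rewrite disjoints_subset sub0set.
  by rewrite subsetI subxx andbT.
rewrite EP (eq_bigr (fun=> 1 - p ^+ 2)) => [|y].
  rewrite prodr_const; apply: ler_wiXn2l => //.
    by rewrite gerBl sqr_ge0.
  rewrite cardsCs setCK card_ord leq_sub2l // cardsE.
  by rewrite (leq_trans (card_size _)) //= size_tuple.
rewrite !inE /= !negb_or => /and3P[yu yw _].
rewrite PrC; congr (1 - _); rewrite Pr_edges.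
  rewrite cards2; case: eqP => // /setP /(_ u).
  by rewrite !inE eqxx eq_sym (negPf yu) (negPf uw).
by move=> e; rewrite !inE => /orP[]/eqP ->; rewrite cards2 ?yw // eq_sym yu.
Qed.

End EdgeProbability.

(** * Isolated facets *)

Definition isolated_facet (T : eqType) (X : pred (seq T)) (s : seq T) : Prop :=
  facet X s /\
  forall r t, codim1_face r s -> facet X t -> subseq r t -> t = s.

(** The later of the two in a shelling would be attached along a codimension-one face of an earlier
    facet, which isolation forbids. *)
Lemma two_isolated_not_shellable (T : eqType) (X : pred (seq T)) s t :
  isolated_facet X s -> isolated_facet X t -> s != t -> ~ shellable X.
Proof.
move=> [sX sI] [tX tI] st [F [uF FX shF]].
wlog lt : s t sX sI tX tI st / (index s F < index t F)%N => [W|].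
  have [|ge] := ltnP (index s F) (index t F); first exact: (W s t).
  apply: (W t s) => //; first by rewrite eq_sym.
  rewrite ltn_neqAle ge andbT; apply: contraNneq st => ts.
  have /FX sF := sX; have /FX tF := tX.
  by rewrite -(nth_index s sF) -(nth_index s tF) ts.
have tF : t \in F by apply/FX.
have sz : (0 < index t F < size F)%N by rewrite index_mem tF andbT; lia.
have [R [R0 Rc RE]] := shF _ sz; rewrite nth_index // in Rc RE.
case: R R0 Rc RE => // r R _ Rc RE.
have rt := Rc r (mem_head _ _).
have := RE r; rewrite /= subseq_refl /= => /andP[_ /hasP[u uF' ru]].
have uI : u \in F by exact: mem_take uF'.
have ut := tI r u rt (proj1 (FX u) uI) ru.
by move: uF'; rewrite ut in_take ?ltnn // index_mem.
Qed.

Section IsolatedPath.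
Variables (n : nat) (g : sgraph n) (a b : 'I_n).
Implicit Types (s t : seq 'I_n).

Lemma subseq_ins1 s t : subseq s t -> size t = (size s).+1 ->
  exists i y, (i <= size s)%N /\ t = ins i y s.
Proof.
elim: t s => // x t IH [|z s] /= st sz.
  by exists 0, x; split=> //; case: t sz {IH st} => // -[].
case: eqVneq st => [zx|zx] st.
  have [i [y [si ->]]] := IH s st (eq_add_S _ _ sz).
  by exists i.+1, y; rewrite zx.
exists 0, x; split=> //; congr (_ :: _).
by apply/esym/eqP; rewrite -(size_subseq_leqif st) /=; apply/eqP; case: sz.
Qed.

(* The conditions say that the path has no chord between vertices at distance
   two along it, and that no outside vertex is joined to two such vertices. *)
Lemma isolated_path l s : uniq (a :: rcons s b) ->
    path (adj g) a (rcons s b) -> (size s).+1 = l -> s != [::] ->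
    (forall s1 y s2, s = s1 ++ y :: s2 -> ~~ adj g (last a s1) (head b s2)) ->
    (forall s1 y s2 w, s = s1 ++ y :: s2 -> w \notin a :: rcons s b ->
       adj g (last a s1) w -> ~~ adj g w (head b s2)) ->
  isolated_facet (ET g l a b) s.
Proof.
move=> us ps sl s0 chord outside.
have lens : leo (len g (a :: rcons s b)) l.
  by rewrite -sl -(size_rcons s b); apply: len_of_path.
have sX : ET g l a b s by rewrite ET_ET0 s0 /ET0 us.
have Xsize t : ET g l a b t -> (size t <= size s)%N.
  by rewrite ET_ET0 => /andP[_ /ET0_size]; rewrite -sl ltnS.
have maxs t : ET g l a b t -> subseq s t -> t = s.
  move=> /Xsize ts st; apply/esym/eqP.
  by rewrite -(size_subseq_leqif st) eqn_leq ts size_subseq.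
split=> [//|r t rs [tX tmax] rt].
have [/= y ys rE] := codim1_faceP (subseq_uniq (subseq_rcons s b) (proj2 (andP us))) rs.
have /andP[rsub /eqP szr] := rs.
(* [t] cannot be [r] itself, which is a proper face of [s]; so it has exactly one more vertex. *)
have szt : size t = (size r).+1.
  apply/eqP; rewrite eqn_leq szr Xsize //=.
  rewrite -szr ltnNge; apply/negP => tr.
  have tr' : r = t by apply/eqP; rewrite -(size_subseq_leqif rt) eqn_leq tr size_subseq.
  have := tmax s sX; rewrite -tr' => /(_ rsub) sr.
  by rewrite sr in szr; case: (n_Sn _ (esym szr)).
have [i [w [ir tE]]] := subseq_ins1 rt szt.
have ut : uniq (a :: rcons t b) by move: tX; rewrite ET_ET0 => /and3P[].
(* [t] has the maximal number [l - 1] of vertices, so all its gaps are edges. *)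
have pt : path (adj g) a (rcons t b).
  move: tX; rewrite ET_ET0 => /and3P[_ _ lt]; apply: path_of_len ut lt _.
  by rewrite size_rcons szt szr sl.
have wr : w \notin a :: rcons r b.
  move: ut; rewrite tE -ins_rcons // -[a :: ins i _ _]/(ins i.+1 w (a :: rcons r b)).
  by rewrite uniq_ins => /andP[].
case/splitPr: ys sl us chord outside rE szr pt => s1 s2 sl us chord outside rE szr pt.
have usm : uniq (s1 ++ y :: s2).
  by move: us; rewrite /= rcons_uniq => /and3P[].
have rE' : r = s1 ++ s2.
  rewrite rE filter_cat /= eqxx /=; move: usm; rewrite cat_uniq /= => /and3P[_].
  rewrite negb_or => /andP[y1 _] /andP[y2 _].
  have keep s' : y \notin s' -> seq.filter (predC1 y) s' = s'.
    by move=> ys'; apply/all_filterP/allP => z zs' /=; apply: contraNneq ys' => <-.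
  by rewrite !keep.
have nchord := chord s1 y s2 erefl.
rewrite {}tE {}rE' in wr pt ir *.
(* If [w] is not put where [y] was, the two neighbours of [y] become consecutive on the path [t],
   which is a forbidden chord. In the place of [y], a vertex [w] other than [y] would be an outside
   vertex joined to both. *)
have [lt|gt|eqi] := ltngtP i (size s1).
- case/negP: nchord; rewrite /ins take_cat drop_cat lt -cat_cons catA in pt.
  move: pt; rewrite rcons_cat cat_path => /andP[_].
  have -> : last a (take i s1 ++ w :: drop i s1) = last a s1.
    by rewrite -[in RHS](cat_take_drop i s1) !last_cat /= (drop_nth w) //.
  by case: (s2) => [|z s2'] /= /andP[].
- case/negP: nchord; rewrite /ins take_cat drop_cat ltnNge (ltnW gt) /= in pt.
  move: pt; rewrite -catA rcons_cat cat_path => /andP[_].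
  move: gt ir; rewrite size_cat; case: (s2) => [|z s2']; 
    first by rewrite addn0 => gt; rewrite leqNgt gt.
  move=> gt _.
  have <- : (i - size s1).-1.+1 = (i - size s1)%N by rewrite prednK // subn_gt0.
  by move=> /= /andP[].
rewrite {}eqi /ins take_size_cat // drop_size_cat // in pt *.
congr (_ ++ _ :: _); apply/eqP; apply: contraT => wy.
move: pt; rewrite rcons_cat cat_path => /andP[_] /=.
have ww : w \notin a :: rcons (s1 ++ y :: s2) b.
  move: wr; rewrite !inE !mem_rcons !inE !mem_cat inE !negb_or wy.
  by move=> /and4P[-> -> -> ->].
have := outside s1 y s2 w erefl ww.
case: (s2) => [|z s2'] /= H /andP[/H nw]; first by rewrite (negPf nw).
by rewrite (negPf nw).
Qed.

End IsolatedPath.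

(** * Random induced cycles *)

Section LayeredCycles.
Variables (n m r : nat) (a b : 'I_n) (vtx : bool -> 'I_r -> 'I_m -> 'I_n).
Hypothesis r1 : (1 < r)%N.
Hypothesis ab : a != b.
Hypothesis vtx_inj : forall e i j e' i' j',
  vtx e i j = vtx e' i' j' -> [/\ e = e', i = i' & j = j'].
Hypothesis vtxa : forall e i j, vtx e i j != a.
Hypothesis vtxb : forall e i j, vtx e i j != b.

(** There are two sides of [r] disjoint layers with [m] vertices each. A layout picks one vertex per
    layer, giving a potential path of length [r + 1] from [a] to [b]; one layout for each side gives
    a potential cycle. *)
Let layout := {ffun 'I_r -> 'I_m}.
Implicit Types (e : bool) (x : layout) (z : {ffun bool -> layout}) (u w y : 'I_n).

Definition inner e x : seq 'I_n := [seq vtx e i (x i) | i <- enum 'I_r].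

(* The default value makes [pt e x r.+1] the endpoint [b]. *)
Definition pt e x (i : nat) : 'I_n := nth b (a :: inner e x) i.

Lemma size_inner e x : size (inner e x) = r.
Proof. by rewrite size_map size_enum_ord. Qed.

Lemma pt0 e x : pt e x 0 = a. Proof. by []. Qed.

Lemma pt_vtx e x (i : 'I_r) : pt e x i.+1 = vtx e i (x i).
Proof. by rewrite /pt /= (nth_map i) ?size_enum_ord // nth_ord_enum. Qed.

Lemma pt_last e x : pt e x r.+1 = b.
Proof. by rewrite /pt /= nth_default // size_inner. Qed.

(** The position of a vertex on every layered path through it, independent of side and layout; two
    such paths can thus meet only at equal positions. Vertices outside the layers get the default
    0. *)
Definition level u : nat :=
  if u == a then 0 else if u == b then r.+1 else
  if [pick t : bool * 'I_r * 'I_m | vtx t.1.1 t.1.2 t.2 == u] is Some t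
  then t.1.2.+1 else 0.

Lemma level_pt e x i : (i <= r.+1)%N -> level (pt e x i) = i.
Proof.
case: i => [|i]; first by rewrite pt0 /level eqxx.
rewrite ltnS leq_eqVlt => /orP[/eqP ->|ir].
  by rewrite pt_last /level eq_sym (negPf ab) eqxx.
rewrite (pt_vtx e x (Ordinal ir)) /level (negPf (vtxa _ _ _)) (negPf (vtxb _ _ _)).
case: pickP => [t /eqP tE|/(_ (e, Ordinal ir, x (Ordinal ir)))]; last by rewrite eqxx.
by have [_ -> _] := vtx_inj tE.
Qed.

Lemma pt_level e x i e' x' i' : (i <= r.+1)%N -> (i' <= r.+1)%N ->
  pt e x i = pt e' x' i' -> i = i'.
Proof. by move=> ir ir' /(congr1 level); rewrite !level_pt. Qed.

Lemma pt_eq e x e' x' (i : 'I_r) :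
  pt e x i.+1 = pt e' x' i.+1 -> e = e' /\ x i = x' i.
Proof. by rewrite !pt_vtx => /vtx_inj[]. Qed.

Lemma pt_side e x e' x' i : (0 < i <= r)%N -> pt e x i = pt e' x' i -> e = e'.
Proof.
by case: i => // i ir; rewrite -[i]/(nat_of_ord (Ordinal ir)) => /pt_eq[].
Qed.

Lemma ptsE e x : a :: rcons (inner e x) b = [seq pt e x i | i <- iota 0 r.+2].
Proof.
apply: (@eq_from_nth _ b) => [|i].
  by rewrite /= size_rcons size_inner size_map size_iota.
rewrite [size _]/= size_rcons size_inner => ir.
rewrite (nth_map 0%N) ?size_iota // nth_iota // add0n /pt.
case: i ir => //= i _; rewrite nth_rcons; case: ltngtP => // ir.
  by rewrite nth_default // ltnW.
by rewrite nth_default // ir.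
Qed.

Lemma mem_pts e x i : (i <= r.+1)%N -> pt e x i \in a :: rcons (inner e x) b.
Proof. by move=> ir; rewrite ptsE map_f // mem_iota. Qed.

Lemma uniq_pts e x : uniq (a :: rcons (inner e x) b).
Proof.
rewrite ptsE map_inj_in_uniq ?iota_uniq // => i j.
by rewrite !mem_iota !add0n !ltnS => ir jr; apply: pt_level.
Qed.

Definition edge e x i : {set 'I_n} := [set pt e x i; pt e x i.+1].

(** Edge [i] joins levels [i] and [i + 1], so a common edge has one position and one orientation. *)
Lemma edge_inj e x i e' x' i' : (i <= r)%N -> (i' <= r)%N ->
  edge e x i = edge e' x' i' ->
  [/\ i = i', pt e x i = pt e' x' i & pt e x i.+1 = pt e' x' i.+1].
Proof.
move=> ir ir' eE.
have := set21 (pt e x i) (pt e x i.+1); rewrite -/(edge e x i) eE !inE.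
have := set22 (pt e x i) (pt e x i.+1); rewrite -/(edge e x i) eE !inE.
case/orP=> /eqP E1; case/orP=> /eqP E2;
  have := pt_level _ _ E1; have := pt_level _ _ E2;
  rewrite ?ltnS ?ltnS ?ir ?ir' ?(leqW ir) ?(leqW ir') => /(_ isT isT) i2 /(_ isT isT) i1;
  try by clear - i1 i2; lia.
by move: E1 E2; rewrite i2.
Qed.

(** Every edge has an endpoint in some layer, and that layer belongs to one side. *)
Lemma edge_side e x i e' x' : (i <= r)%N -> edge e x i = edge e' x' i -> e = e'.
Proof.
move=> ir /(edge_inj ir ir)[_ E1 E2]; case: i ir E1 E2 => [|i] ir E1 E2.
  by apply: pt_side E2; exact: ltnW r1.
by apply: pt_side E1.
Qed.

Lemma card_edge e x i : (i <= r)%N -> #|edge e x i| = 2.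
Proof.
move=> ir; rewrite cards2; case: eqP => // /pt_level -/(_ (leqW ir) ir); lia.
Qed.

Definition cycle_edges z := [set edge t.1 (z t.1) t.2 | t : bool * 'I_r.+1].
Definition cycle_verts z := [set pt t.1 (z t.1) t.2 | t : bool * 'I_r.+2].

Lemma cycle_edge_inj z : injective (fun t : bool * 'I_r.+1 => edge t.1 (z t.1) t.2).
Proof.
move=> [e i] [e' i'] /= eE; have [ii' _ _] := edge_inj (leq_ord i) (leq_ord i') eE.
rewrite -ii' in eE; rewrite (edge_side (leq_ord i) eE); congr (_, _); exact: val_inj.
Qed.

Lemma card_cycle_edges z : #|cycle_edges z| = (2 * r.+1)%N.
Proof.
by rewrite card_imset ?card_prod ?card_bool ?card_ord //; exact: cycle_edge_inj.
Qed.

Lemma card_cycle_verts z : (#|cycle_verts z| <= 2 * r.+2)%N.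
Proof.
by rewrite (leq_trans (leq_imset_card _ _)) // card_prod card_bool card_ord.
Qed.

Lemma card2_cycle_edges z f : f \in cycle_edges z -> #|f| = 2.
Proof. by case/imsetP=> -[e i] _ ->; rewrite card_edge // leq_ord. Qed.

Definition chords z : {set {set 'I_n}} :=
  [set f : {set 'I_n} |
    [&& f \subset cycle_verts z, #|f| == 2 & f \notin cycle_edges z]].

Definition sparse_at z y (J : {set {set 'I_n}}) :=
  [forall t in setX (cycle_verts z) (cycle_verts z),
     (t.1 != t.2) ==> ~~ ([set [set t.1; y]; [set y; t.2]] \subset J)].

(** The cycle is present and induced, and no other vertex has two neighbours on it; these conditions
    bear on disjoint sets of potential edges. *)
Definition good z : pred {set {set 'I_n}} := fun J =>
  ((cycle_edges z \subset J) && [disjoint chords z & J]) &&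
  [forall y in ~: cycle_verts z, sparse_at z y J].

Lemma mem_cycle_verts z e i : (i <= r.+1)%N -> pt e (z e) i \in cycle_verts z.
Proof. by move=> ir; apply/imsetP; exists (e, Ordinal (ir : (i < r.+2)%N)). Qed.

Lemma mem_cycle_edges z e i : (i <= r)%N -> edge e (z e) i \in cycle_edges z.
Proof. by move=> ir; apply/imsetP; exists (e, Ordinal (ir : (i < r.+1)%N)). Qed.

Lemma good_edge z (g : sgraph n) u w : good z (val g) ->
  u \in cycle_verts z -> w \in cycle_verts z -> adj g u w ->
  exists e i, [/\ (i <= r)%N & [set u; w] = edge e (z e) i].
Proof.
case/andP=> /andP[_ dJ] _ uC wC uw.
have uw2 : #|[set u; w]| == 2 by have /forall_inP/(_ _ uw) := valP g.
have /imsetP[[e i] _ ->] : [set u; w] \in cycle_edges z.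
  apply: contraT => nE; have := disjointFl dJ uw; rewrite inE uw2 nE !andbT.
  by move/negP; case; apply/subsetP=> v; rewrite !inE => /orP[]/eqP->.
by exists e, i; rewrite leq_ord.
Qed.

Lemma good_level z (g : sgraph n) u w : good z (val g) ->
  u \in cycle_verts z -> w \in cycle_verts z -> adj g u w ->
  level w = (level u).+1 \/ level u = (level w).+1.
Proof.
move=> gz uC wC uw; have [e [i [ir uwE]]] := good_edge gz uC wC uw.
have := set21 u w; have := set22 u w; rewrite uwE !inE.
have nuw : u != w by apply: contraTneq uw => ->; rewrite adj_irr.
by move=> /orP[]/eqP wE /orP[]/eqP uE; move: nuw; rewrite wE uE ?eqxx // => _;
  rewrite !level_pt ?(leqW ir) //; [right|left].
Qed.

(** Each edge of the cycle lies on one side, and an inner vertex belongs to a single side. *)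
Lemma good_side z (g : sgraph n) u e k : good z (val g) -> (0 < k <= r)%N ->
  u \in cycle_verts z -> adj g u (pt e (z e) k) ->
  exists2 i, (i <= r.+1)%N & u = pt e (z e) i.
Proof.
move=> gz /andP[k0 kr] uC uw.
have wC : pt e (z e) k \in cycle_verts z by apply: mem_cycle_verts; exact: leqW.
have [e' [i [ir uwE]]] := good_edge gz uC wC uw.
set w := pt e (z e) k in uw wC uwE.
have := set21 u w; have := set22 u w; rewrite uwE !inE.
have nuw : u != w by apply: contraTneq uw => ->; rewrite adj_irr.
have side j : (j <= r.+1)%N -> w = pt e' (z e') j -> e = e'.
  move=> jr wE; have kj := pt_level (leqW kr) jr wE.
  by move: wE; rewrite -kj; apply: pt_side; rewrite k0.
move=> /orP[]/eqP wE /orP[]/eqP uE; move: nuw; rewrite ?wE ?uE ?eqxx // => _.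
  by exists i.+1 => //; rewrite (side i (leqW ir) wE).
by exists i; rewrite ?(leqW ir) // (side i.+1 ir wE).
Qed.

Lemma good_isolated z (g : sgraph n) e : good z (val g) ->
  isolated_facet (ET g r.+1 a b) (inner e (z e)).
Proof.
move=> gz; have /andP[/andP[/subsetP EJ dJ] /forall_inP sp] := gz.
have split_pts s1 y s2 : inner e (z e) = s1 ++ y :: s2 ->
    [/\ last a s1 = pt e (z e) (size s1), head b s2 = pt e (z e) (size s1).+2 &
        (size s1 < r)%N].
  move=> sE; have := size_inner e (z e); rewrite /pt sE size_cat /= => <-; split.
  - by rewrite -cat_cons nth_cat /= leqnn -last_nth.
  - by rewrite nth_cat ltnNge leqnSn /= subSn // subnn /= nth0.
  by rewrite -addSnnS leq_addr.
apply: isolated_path.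
- exact: uniq_pts.
- apply/(pathP b) => i; rewrite size_rcons size_inner ltnS => ir.
  have -> : nth b (a :: rcons (inner e (z e)) b) i = pt e (z e) i.
    by rewrite ptsE (nth_map 0%N) ?size_iota ?nth_iota // ltnW.
  have -> : nth b (rcons (inner e (z e)) b) i = pt e (z e) i.+1.
    rewrite -[LHS]/(nth b (a :: rcons (inner e (z e)) b) i.+1).
    by rewrite ptsE (nth_map 0%N) ?size_iota ?nth_iota.
  exact/EJ/mem_cycle_edges.
- by rewrite size_inner.
- by rewrite -size_eq0 size_inner -lt0n ltnW.
- move=> s1 y s2 /split_pts[-> -> sr]; apply/negP => uw.
  have := good_level gz (mem_cycle_verts z e (leqW (ltnW sr)))
    (@mem_cycle_verts z e (size s1).+2 sr) uw.
  by rewrite !level_pt ?(leqW (ltnW sr)) //; clear; lia.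
move=> s1 y s2 w /split_pts[-> -> sr]; set i := size s1 in sr * => wE iw.
apply/negP=> wi.
have iC : pt e (z e) i \in cycle_verts z.
  by apply: mem_cycle_verts; rewrite leqW // ltnW.
have iC' : pt e (z e) i.+2 \in cycle_verts z by apply: mem_cycle_verts.
case: (boolP (w \in cycle_verts z)) => [/imsetP[[e' k] _ /= wk]|wC]; last first.
  have ne : pt e (z e) i != pt e (z e) i.+2.
    by apply/eqP=> /(@pt_level e (z e) i e (z e) i.+2 (leqW (ltnW sr)) sr); clear; lia.
  have := sp w; rewrite inE wC.
  move=> /(_ isT) /forall_inP /(_ (pt e (z e) i, pt e (z e) i.+2)).
  rewrite inE iC iC' /= ne => /(_ isT) /negP; case.
  by apply/subsetP=> f; rewrite !inE => /orP[]/eqP->.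
have kr := leq_ord k.
have nee : e' != e.
  by apply: contraNneq wE => ee; rewrite wk ee mem_pts.
have k0r : (0 < k <= r)%N.
  rewrite lt0n; apply/andP; split.
    by apply: contraNneq wE => k0; rewrite wk k0 pt0 mem_head.
  rewrite -ltnS ltn_neqAle kr andbT.
  by apply: contraNneq wE => k0; rewrite wk k0 pt_last inE mem_rcons mem_head orbT.
rewrite wk in iw wi; rewrite adj_sym in wi.
have [j jr ijE] := good_side gz k0r iC iw.
have [j' jr' ijE'] := good_side gz k0r iC' wi.
have ij := pt_level (leqW (ltnW sr)) jr ijE; rewrite -ij in ijE.
have sr2 : (i.+2 <= r.+1)%N by [].
have ij' := pt_level sr2 jr' ijE'; rewrite -ij' in ijE'.
(* Both neighbours of [w] lie on both sides, so they are [a] and [b], two steps apart; this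
   contradicts [1 < r]. *)
have i0 : ~~ (0 < i <= r)%N.
  by apply: contra nee => ir; apply/eqP/esym; apply: pt_side ijE.
have i2 : ~~ (0 < i.+2 <= r)%N.
  by apply: contra nee => ir; apply/eqP/esym; apply: pt_side ijE'.
by move: r1 sr i0 i2; clear; lia.
Qed.

Lemma good_not_shellable z (g : sgraph n) : good z (val g) ->
  ~ shellable (ET g r.+1 a b).
Proof.
move=> gz.
apply: two_isolated_not_shellable (good_isolated true gz) (good_isolated false gz) _.
apply/eqP => E.
have := @pt_side true (z true) false (z false) 1.
by rewrite /pt /= E ltnW // => /(_ isT erefl).
Qed.

(** * Second moment of the number of good cycles *)

Variables (R : realType) (p : R).
Hypothesis p01 : 0 <= p <= 1.

(** The cost of the [i]-th edge of a second path given the first: one if shared, [p] if new. *)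
Let agree e x0 x i : R := if edge e x0 i == edge e x i then 1 else p.

(** A shared edge forces agreement at both ends, so each edge may be charged to either end. Let the
    layouts differ in layer [i0]: edges up to [i0] are charged to their far end, later ones to their
    near end. Level [i0 + 1] is charged twice, whence the extra factor [p]. *)
Lemma prod_agree_le e x0 x : x != x0 ->
  \prod_(i < r.+1) agree e x0 x i <=
  p * \prod_(i < r) (if x i == x0 i then 1 else p).
Proof.
have /andP[p0 p1] := p01 => xx0.
have [i0 ni0] : exists i0, x i0 != x0 i0.
  apply/existsP; apply: contraNT xx0; rewrite negb_exists => /forallP xE.
  by apply/eqP/ffunP => i; apply/eqP; rewrite -[_ == _]negbK.
pose psi k : R := if pt e x k == pt e x0 k then 1 else p.
have psi01 k : 0 <= psi k by rewrite /psi; case: ifP.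
have psiE (i : 'I_r) : psi i.+1 = if x i == x0 i then 1 else p.
  rewrite /psi; congr (if _ then _ else _); apply/eqP/eqP => [/pt_eq[]//|xi].
  by rewrite !pt_vtx xi.
have psi_i0 : psi i0.+1 = p by rewrite psiE (negPf ni0).
have agree_le i : (i <= r)%N -> agree e x0 x i <= psi i /\ agree e x0 x i <= psi i.+1.
  move=> ir; rewrite /agree /psi; case: eqP => [/(edge_inj ir ir)[_ -> ->]|_].
    by rewrite !eqxx.
  by split; case: ifP.
apply: (@le_trans _ _ (\prod_(i < r.+1) (if (i <= i0)%N then psi i.+1 else psi i))).
  apply: ler_prod => i _; have [le1 le2] := agree_le i (leq_ord i).
  rewrite {1}/agree; case: ifP => _; case: ifP => _; rewrite ?ler01 ?p0 //.
have i0r := ltn_ord i0.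
rewrite -(eq_bigr _ (fun i _ => psiE i)) -(big_mkord xpredT (fun i => psi i.+1)).
rewrite -(big_mkord xpredT (fun i => if (i <= i0)%N then psi i.+1 else psi i)).
rewrite (big_cat_nat (n := i0.+1)) //=; last by rewrite ltnS ltnW.
rewrite [X in _ <= p * X](big_cat_nat (n := i0.+1)) //= mulrCA.
rewrite [X in X * _ <= _](eq_big_nat _ _ (F2 := fun i => psi i.+1)); last first.
  by move=> i /andP[_]; rewrite ltnS => ->.
rewrite [X in _ * X <= _](eq_big_nat _ _ (F2 := psi)); last first.
  by move=> i /andP[ii _]; rewrite leqNgt ii.
by rewrite [X in _ * X <= _]big_ltn ?ltnS // psi_i0 big_add1.
Qed.

Lemma sum_agree_le e x0 :
  \sum_(x : layout) \prod_(i < r.+1) agree e x0 x i <=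
  1 + p * (1 + m%:R * p) ^+ r.
Proof.
have /andP[p0 p1] := p01; rewrite (bigD1 x0) //= lerD //.
  by apply: prodr_ile1 => i _; rewrite /agree eqxx ler01 lexx.
apply: (@le_trans _ _ (\sum_(x : layout)
    p * \prod_(i < r) (if x i == x0 i then 1 else p))).
  rewrite big_mkcond; apply: ler_sum => x _; case: ifP => [|_].
    exact: prod_agree_le.
  by apply: mulr_ge0 => //; apply: prodr_ge0 => i _; case: ifP.
rewrite -mulr_sumr ler_wpM2l //.
rewrite -(bigA_distr_bigA (fun (i : 'I_r) (j : 'I_m) => if j == x0 i then 1 else p)).
rewrite -[X in _ <= _ ^+ X]card_ord -prodr_const; apply: ler_prod => i _.
apply/andP; split; first by apply: sumr_ge0 => j _; case: ifP.
rewrite (bigD1 (x0 i)) //= eqxx lerD2l.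
apply: (@le_trans _ _ (\sum_(j : 'I_m) p)).
  by rewrite big_mkcond; apply: ler_sum => j _; case: eqP.
by rewrite sumr_const card_ord mulr_natl.
Qed.

(** An edge common to both cycles has the same side and position in each, so the edges of the second
    cycle that are new are those where the layouts give different edges. *)
Lemma Pr_two_cycles z z' :
  Pr (edge_prob p) (fun J => good z J && good z' J) <=
  p ^+ (2 * r.+1) * \prod_e \prod_(i < r.+1) agree e (z e) (z' e) i.
Proof.
have q01 := edge_prob01 (n := n) p01.
apply: (@le_trans _ _ (Pr (edge_prob p)
    (fun J => cycle_edges z :|: cycle_edges z' \subset J))).
  apply: le_Pr => // J /andP[/andP[/andP[zJ _] _] /andP[/andP[zJ' _] _]].
  by rewrite subUset zJ zJ'.
rewrite Pr_edges => [|f]; last first.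
  by rewrite inE => /orP[] /card2_cycle_edges.
pose T := [set t : bool * 'I_r.+1 |
  edge t.1 (z t.1) t.2 != edge t.1 (z' t.1) t.2].
have newE : cycle_edges z' :\: cycle_edges z =
    [set edge t.1 (z' t.1) t.2 | t : bool * 'I_r.+1 in T].
  apply/setP=> f; rewrite inE; apply/andP/imsetP => [[fz /imsetP[t _ fE]]|[t tT fE]].
    exists t => //; rewrite inE; apply: contraNneq fz => tE.
    by rewrite fE -tE; apply/imsetP; exists t.
  split; last by rewrite fE; apply/imsetP; exists t.
  apply: contraTN tT => /imsetP[[e i] _]; rewrite inE negbK fE => tE.
  have [ti _ _] := edge_inj (leq_ord _) (leq_ord _) tE.
  have tE' := tE; rewrite /= -ti in tE'.
  have te := edge_side (leq_ord _) tE'.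
  by rewrite tE' te.
rewrite -(cardsID (cycle_edges z)) setUK setDUl setDv set0U newE card_cycle_edges.
rewrite card_imset; last exact: cycle_edge_inj.
rewrite pair_bigA exprD /= -prodr_const big_mkcond /= le_eqVlt; apply/orP; left.
apply/eqP; congr (_ * _); apply: eq_bigr => t _; rewrite inE /agree.
by case: eqP.
Qed.

Definition good_count J : R := \sum_z (good z J)%:R.

Lemma second_moment :
  Ex (edge_prob p) (fun J => good_count J ^+ 2) <=
  (m ^ (2 * r))%:R * (p ^+ (2 * r.+1) * (1 + p * (1 + m%:R * p) ^+ r) ^+ 2).
Proof.
have /andP[p0 p1] := p01; have q01 := edge_prob01 (n := n) p01.
have -> : Ex (edge_prob p) (fun J => good_count J ^+ 2) =
    \sum_z \sum_z' Pr (edge_prob p) (fun J => good z J && good z' J).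
  under [RHS]eq_bigr => z _ do
    rewrite -(Ex_sum _ _ (fun z' J => (good z J && good z' J)%:R)).
  rewrite -(Ex_sum _ _ (fun z J => \sum_z' (good z J && good z' J)%:R)).
  apply: eq_bigr => J _; congr (_ * _).
  rewrite expr2 mulr_suml; apply: eq_bigr => z _; rewrite mulr_sumr.
  by apply: eq_bigr => z' _; rewrite -natrM mulnb.
have -> : (m ^ (2 * r))%N = #|{: {ffun bool -> layout}}|.
  by rewrite !card_ffun card_bool !card_ord -expnM mulnC.
rewrite mulr_natl -sumr_const; apply: ler_sum => z _.
apply: (le_trans (ler_sum _ (fun z' _ => Pr_two_cycles z z'))).
rewrite -mulr_sumr ler_wpM2l ?exprn_ge0 //.
rewrite -(bigA_distr_bigA (fun e x => \prod_(i < r.+1) agree e (z e) x i)).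
rewrite -[X in _ <= _ ^+ X]card_bool -prodr_const; apply: ler_prod => e _.
rewrite sum_agree_le andbT; apply: sumr_ge0 => x _; apply: prodr_ge0 => i _.
by rewrite /agree; case: ifP.
Qed.

(** The factors bound the cycle edges, the chords (at most the number of subsets of the cycle) and
    the outside vertices (union bound over ordered pairs of cycle vertices). The count [2 * r.+2] of
    cycle vertices includes [a] and [b] twice. *)
Lemma Pr_good z : (2 * r.+2)%:R ^+ 2 * p ^+ 2 <= 1 :> R ->
  p ^+ (2 * r.+1) * (1 - p) ^+ (2 ^ (2 * r.+2)) *
    (1 - (2 * r.+2)%:R ^+ 2 * p ^+ 2) ^+ n <= Pr (edge_prob p) (good z).
Proof.
move=> K1; have /andP[p0 p1] := p01; have q01 := edge_prob01 (n := n) p01.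
set C := cycle_verts z; set q := edge_prob p.
have CK := card_cycle_verts z; rewrite -/C in CK.
(* [B0] and the [B y] are the disjoint coordinate sets on which the independent events depend. *)
pose B0 : {set {set 'I_n}} := powerset C.
pose B y : {set {set 'I_n}} := [set [set u; y] | u in C].
have EB0 : cycle_edges z \subset B0.
  apply/subsetP=> f /imsetP[[e i] _ ->]; rewrite inE; apply/subsetP=> u.
  by rewrite !inE => /orP[]/eqP ->; apply: mem_cycle_verts;
    rewrite ?(leqW (leq_ord i)) // ltnS leq_ord.
have DB0 : chords z \subset B0 by apply/subsetP=> f; rewrite !inE => /andP[].
have -> : Pr q (good z) =
    Pr q (fun J => (cycle_edges z \subset J) && [disjoint chords z & J]) *
    \prod_(y in ~: C) Pr q (sparse_at z y).
  apply: (@Pr_all _ _ q _ B (sparse_at z) (~: C) B0) => [y w|y|J|y J].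
  - rewrite !inE => yC wC yw; rewrite -setI_eq0; apply/eqP/setP=> f; rewrite !inE.
    apply/negP=> /andP[/imsetP[u uC ->] /imsetP[v vC] /setP/(_ y)].
    by rewrite !inE eqxx orbT (negPf yw) orbF => /esym/eqP yv; rewrite yv vC in yC.
  - rewrite inE => yC; rewrite -setI_eq0; apply/eqP/setP=> f; rewrite !inE.
    apply/negP=> /andP[/subsetP fC /imsetP[u uC fE]].
    by move: (fC y); rewrite fE !inE eqxx orbT (negPf yC) => /(_ isT).
  - congr (_ && _); first by rewrite subsetI EB0 andbT.
    rewrite -!setI_eq0 [J :&: _]setIC setIA; congr (_ :&: _ == _).
    by apply/esym/setIidPl.
  rewrite inE => yC; apply: eq_forallb => -[u w] /=.
  case: (boolP (_ \in _)) => // /setXP[uC wC] /=; congr (_ ==> ~~ _).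
  have PB : [set [set u; y]; [set y; w]] \subset B y.
    rewrite subUset !sub1set; apply/andP; split; apply/imsetP.
      by exists u.
    by exists w => //; rewrite setUC.
  by rewrite subsetI PB andbT.
apply: ler_pM.
- by rewrite mulr_ge0 // exprn_ge0 // subr_ge0.
- by rewrite exprn_ge0 // subr_ge0.
- rewrite Pr_cyl; last first.
    rewrite -setI_eq0; apply/eqP/setP=> f; rewrite !inE.
    by apply/negP=> /and4P[fE _ _]; rewrite fE.
  rewrite (eq_bigr (fun=> p)) => [|f /card2_cycle_edges f2]; last first.
    by rewrite /q /edge_prob f2.
  rewrite prodr_const card_cycle_edges ler_wpM2l ?exprn_ge0 //.
  rewrite (eq_bigr (fun=> 1 - p)) => [|f]; last first.
    by rewrite inE /q /edge_prob => /and3P[_ -> _].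
  rewrite prodr_const; apply: ler_wiXn2l.
  - by rewrite subr_ge0.
  - by rewrite gerBl.
  rewrite (leq_trans (subset_leq_card DB0)) // card_powerset leq_exp2l //.
set K := (2 * r.+2)%:R ^+ 2 * p ^+ 2 in K1 *.
apply: (@le_trans _ _ (\prod_(y in ~: C) (1 - K))).
  rewrite prodr_const; apply: ler_wiXn2l; rewrite ?subr_ge0 //.
    by rewrite gerBl mulr_ge0 ?sqr_ge0.
  by rewrite (leq_trans (max_card _)) // card_ord.
apply: ler_prod => y; rewrite inE => yC; rewrite subr_ge0 K1 /=.
rewrite lerBlDr -lerBlDl -PrC.
pose S (t : 'I_n * 'I_n) := (t \in setX C C) && (t.1 != t.2).
apply: (@le_trans _ _ (Pr q (fun J => [exists t, S t &&
    ([set [set t.1; y]; [set y; t.2]] \subset J)]))).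
  apply: le_Pr => // J; rewrite negb_forall => /existsP[t].
  by rewrite negb_imply negb_imply negbK andbA => St; apply/existsP; exists t.
apply: (le_trans (Pr_union q01 S _)).
apply: (@le_trans _ _ (\sum_(t in setX C C) p ^+ 2)).
  rewrite big_mkcond [leRHS]big_mkcond; apply: ler_sum => -[u w] _; rewrite /S /=.
  case: ifPn => /andP; last by case: ifP; rewrite ?sqr_ge0.
  case=> tC uw; rewrite tC; have /setXP[uC wC] := tC.
  rewrite /= in uC wC; have yu : y != u by apply: contraNneq yC => ->.
  have yw : y != w by apply: contraNneq yC => ->.
  rewrite Pr_edges => [|f]; last first.
    by rewrite !inE => /orP[]/eqP ->; rewrite cards2 ?yw // eq_sym yu.
  rewrite cards2; case: eqP => // /setP /(_ u).
  by rewrite !inE eqxx [u == y]eq_sym (negPf yu) (negPf uw).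
rewrite sumr_const cardsX -[leLHS]mulr_natl ler_wpM2r ?sqr_ge0 //.
by rewrite -natrX ler_nat -mulnn leq_mul.
Qed.

(* Second moment method, in the form [2 t N - t^2 1_{N > 0} <= N^2]. *)
Lemma exists_good_ge (G t : R) : 0 < t ->
  (forall z, G <= Pr (edge_prob p) (good z)) ->
  (2 * t * ((m ^ (2 * r))%:R * G) - Ex (edge_prob p) (fun J => good_count J ^+ 2))
    / t ^+ 2 <= gnp_prob p (fun g : sgraph n => exists z, good z (val g)).
Proof.
move=> t0 zG; have q01 := edge_prob01 (n := n) p01.
have -> : gnp_prob p (fun g : sgraph n => exists z, good z (val g)) =
    Pr (edge_prob p) (fun J => [exists z, good z J]).
  rewrite -gnp_PrP //; apply: eq_bigl => g.
  by apply/asboolP/asboolP => /existsP.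
rewrite ler_pdivrMr ?exprn_gt0 //.
have EN : (m ^ (2 * r))%:R * G <= Ex (edge_prob p) good_count.
  have -> : (m ^ (2 * r))%N = #|{: {ffun bool -> layout}}|.
    by rewrite !card_ffun card_bool !card_ord -expnM mulnC.
  have -> : Ex (edge_prob p) good_count = \sum_z Pr (edge_prob p) (good z).
    exact: Ex_sum.
  by rewrite mulr_natl -sumr_const; apply: ler_sum => z _; exact: zG.
have : Ex (edge_prob p) (fun J => 2 * t * good_count J - good_count J ^+ 2) <=
    Ex (edge_prob p) (fun J => t ^+ 2 * ([exists z, good z J])%:R).
  apply: le_Ex => // J; case: (boolP [exists z, _]) => [_|nz] /=.
    by rewrite mulr1 -subr_ge0; have := sqr_ge0 (t - good_count J); lra.
  have -> : good_count J = 0.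
    apply: big1 => z _; move: nz; rewrite negb_exists => /forallP/(_ z).
    by move/negPf ->.
  by rewrite mulr0 mulr0 expr0n subr0.
rewrite ExB !ExZ => H; rewrite [leRHS]mulrC; apply: (le_trans _ H).
rewrite lerB // ler_pM2l // mulr_gt0 //.
Qed.

End LayeredCycles.

(** * A uniform lower bound on the probability of non-shellability *)

Section NotShellable.
Variables (R : realType) (r : nat).
Hypothesis r1 : (1 < r)%N.

Let K : R := (2 * r.+2)%:R ^+ 2.
(** [c] bounds from below the conditional probability that a present cycle is good; [W] compares
    [1 + p (1 + m p)^r] with the expected number [m^r p^(r+1)] of layered paths on one side. *)
Let c : R := 2^-1 ^+ (2 ^ (2 * r.+2)) * expR (- (2 * K)).
Let W : R := (4 * r)%:R ^+ r + (4 * r).+1%:R ^+ r.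

Definition nonshellability_constant : R := c ^+ 2 / W ^+ 2.

Lemma nonshellability_constant_gt0 : 0 < nonshellability_constant.
Proof.
have c0 : 0 < c by rewrite mulr_gt0 ?expR_gt0 ?exprn_gt0 // invr_gt0.
have W0 : 0 < W by rewrite ltr_wpDl ?exprn_ge0 ?exprn_gt0 ?ler0n ?ltr0n.
by rewrite divr_gt0 // exprn_gt0.
Qed.

Lemma layers_exist (n m : nat) (a b : 'I_n) : (2 * r * m + 2 <= n)%N ->
  exists vtx : bool -> 'I_r -> 'I_m -> 'I_n,
    [/\ forall e i j e' i' j', vtx e i j = vtx e' i' j' -> [/\ e = e', i = i' & j = j'],
        forall e i j, vtx e i j != a & forall e i j, vtx e i j != b].
Proof.
move=> nm; pose S : {set 'I_n} := ~: [set a; b].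
have cS : (#|{: bool * 'I_r * 'I_m}| <= #|S|)%N.
  rewrite cardsCs setCK !card_prod card_bool !card_ord cards2.
  by case: (a != b); move: nm; clear; lia.
pose f (t : bool * 'I_r * 'I_m) := nth a (enum S) (enum_rank t).
have ft (t : bool * 'I_r * 'I_m) : (enum_rank t < size (enum S))%N.
  by rewrite -cardE (leq_trans (ltn_ord _)).
have fS (t : bool * 'I_r * 'I_m) : f t \in S by rewrite -mem_enum mem_nth.
exists (fun e i j => f (e, i, j)); split=> [e i j e' i' j' fE|e i j|e i j].
- have /enum_rank_inj[-> -> ->//] : enum_rank (e, i, j) = enum_rank (e', i', j').
  by apply/val_inj/eqP; rewrite -(nth_uniq a (ft _) (ft _) (enum_uniq _)); apply/eqP.
- by apply: contraTneq (fS (e, i, j)) => ->; rewrite !inE eqxx.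
by apply: contraTneq (fS (e, i, j)) => ->; rewrite !inE eqxx orbT.
Qed.

(** For [x] up to one half, [(1 - x) (1 + 2 x) >= 1], and [1 + 2 x] is at most the exponential of
    [2 x]. *)
Lemma expR_le_1B (x : R) : 0 <= x -> x <= 2^-1 -> expR (- (2 * x)) <= 1 - x.
Proof.
move=> x0 x1; rewrite expRN.
have y0 : 0 < 1 - x by lra.
rewrite -[leLHS]mul1r ler_pdivrMr ?expR_gt0 //.
apply: (@le_trans _ _ ((1 - x) * (1 + 2 * x))).
  by have : 0 <= x * (1 - 2 * x) by [apply: mulr_ge0; lra]; lra.
by rewrite ler_pM2l // expR_ge1Dx.
Qed.

Lemma not_shellable_ge (n : nat) (p : R) (a b : 'I_n) : a != b ->
    0 <= p <= 1 -> p ^+ 2 * n%:R <= 1 -> 1 <= n%:R * p ->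
    1 <= n%:R ^+ r * p ^+ r.+1 -> 2 * K <= n%:R -> (4 * r + 4 <= n)%N ->
  nonshellability_constant <=
    gnp_prob p (fun g : sgraph n => ~ shellable (ET g r.+1 a b)).
Proof.
move=> ab p01 pn np nrp nK nr; have /andP[p0 p1] := p01.
(* The layers are as large as two sides of [r] layers allow, so [m] is of order [n]. *)
pose m := ((n - 2) %/ (2 * r))%N.
have r0 : (0 < r)%N by exact: ltnW.
have mn : (2 * r * m + 2 <= n)%N.
  have := leq_trunc_div (n - 2) (2 * r); rewrite -/m mulnC.
  by move: nr; clear; lia.
have nm : (n <= 4 * r * m)%N.
  have := ltn_ceil (n - 2) (_ : 0 < 2 * r)%N; rewrite -/m => /(_ ltac:(lia)).
  move: nr; clear; nia.
have [vtx [vinj va vb]] := @layers_exist n m a b mn.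
have n0 : (0 : R) < n%:R by rewrite ltr0n; move: nr; clear; lia.
have p0' : 0 < p.
  by rewrite lt_neqAle p0 andbT; apply: contraTneq np => <-; rewrite mulr0 ler10.
have Kp : K * p ^+ 2 <= K / n%:R.
  by rewrite ler_wpM2l ?sqr_ge0 // -[_^-1]mul1r ler_pdivlMr.
have Kn : K / n%:R <= 2^-1.
  by rewrite ler_pdivrMr // mulrC; move: nK; lra.
have K0 : 0 <= K by exact: sqr_ge0.
have p2 : p <= 2^-1.
  have n4 : (4 : R) <= n%:R by rewrite ler_nat; move: nr; clear; lia.
  rewrite -(@ler_pXn2r _ 2) ?nnegrE ?invr_ge0 //.
  have : p ^+ 2 * 4 <= 1 by apply: le_trans pn; rewrite ler_wpM2l // sqr_ge0.
  by rewrite exprVn -natrX; lra.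
pose G := c * p ^+ (2 * r.+1).
have zG z : G <= Pr (edge_prob p) (good a b vtx z).
  apply: le_trans (Pr_good r1 ab vinj va vb p01 z _); last first.
    by apply: le_trans Kp _; lra.
  rewrite /G mulrC -mulrA ler_wpM2l ?exprn_ge0 //.
  apply: ler_pM; rewrite ?exprn_ge0 ?invr_ge0 ?expR_ge0 //.
    by rewrite ler_pXn2r ?expn_gt0 ?nnegrE ?subr_ge0 ?invr_ge0 //; lra.
  rewrite -/K (_ : - (2 * K) = n%:R * (- (2 * (K / n%:R)))).
    have n0' : (0 < n)%N by rewrite -(ltr0n R).
    rewrite expRM_natl ler_pXn2r ?nnegrE ?expR_ge0 ?subr_ge0 //; last first.
      by apply: le_trans Kp _; lra.
    apply: le_trans (expR_le_1B _ Kn) _; first by rewrite divr_ge0 // ltW.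
    by rewrite lerB.
  by field; rewrite gt_eqF.
pose X : R := m%:R ^+ r * p ^+ r.+1.
have mp : n%:R * p <= (4 * r)%:R * (m%:R * p).
  by rewrite mulrA -natrM ler_pM2r // ler_nat.
have mp0 : 0 <= m%:R * p by rewrite mulr_ge0.
have rX : 1 <= (4 * r)%:R ^+ r * X.
  apply: le_trans nrp _; rewrite /X mulrA -exprMn -natrM ler_wpM2r ?exprn_ge0 //.
  by rewrite ler_pXn2r ?nnegrE ?ler0n // ler_nat.
have X0 : 0 < X.
  have : 0 < (4 * r)%:R ^+ r * X by apply: lt_le_trans rX.
  by rewrite pmulr_rgt0 // exprn_gt0 // ltr0n; move: r0; clear; lia.
(* The first summand of [W] absorbs 1 by [rX]; the second uses [1 <= n p <= 4 r m p], so that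
   [1 + m p <= (4 r + 1) m p]. *)
have WX : 1 + p * (1 + m%:R * p) ^+ r <= W * X.
  rewrite mulrDl lerD // /X (exprS p) [_ * (p * _)]mulrCA [leRHS]mulrCA ler_wpM2l //.
  rewrite -!exprMn ler_pXn2r ?nnegrE ?mulr_ge0 ?addr_ge0 ?ler0n //.
  by rewrite mulrA -addn1 natrD; move: np mp; rewrite !mulrA; lra.
have c0 : 0 < c by rewrite mulr_gt0 ?expR_gt0 ?exprn_gt0 // invr_gt0.
have W0 : 0 < W by rewrite ltr_wpDl ?exprn_ge0 ?exprn_gt0 ?ler0n ?ltr0n.
(* With mean at least [c X^2] and second moment at most [W^2 X^4], this [t] maximises the lower
   bound, giving [c^2 / W^2]. *)
pose t := W ^+ 2 * X ^+ 2 / c.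
have t0 : 0 < t by rewrite divr_gt0 // mulr_gt0 // exprn_gt0.
have MX : (m ^ (2 * r))%:R * p ^+ (2 * r.+1) = X ^+ 2.
  by rewrite /X exprMn natrX -!exprM ![(2 * _)%N]mulnC.
have goodP : gnp_prob p (fun g : sgraph n => exists z, good a b vtx z (val g)) <=
    gnp_prob p (fun g : sgraph n => ~ shellable (ET g r.+1 a b)).
  by apply: gnp_le => // g [z gz]; apply: good_not_shellable gz.
apply: (le_trans _ goodP).
apply: (le_trans _ (exists_good_ge p01 t0 zG)).
rewrite ler_pdivlMr ?exprn_gt0 //.
have := second_moment r1 ab vinj va vb p01; rewrite mulrA MX => EN.
have EN' : Ex (edge_prob p) (fun J => good_count a b vtx R J ^+ 2) <= W ^+ 2 * X ^+ 4.
  apply: le_trans EN _; have -> : W ^+ 2 * X ^+ 4 = X ^+ 2 * (W * X) ^+ 2 by ring.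
  rewrite ler_wpM2l ?sqr_ge0 // ler_pXn2r ?nnegrE //.
    by rewrite addr_ge0 ?mulr_ge0 ?exprn_ge0 ?addr_ge0 ?mulr_ge0 ?ler0n.
  by rewrite mulr_ge0 // ltW.
have -> : (m ^ (2 * r))%:R * G = c * X ^+ 2 by rewrite /G mulrCA MX.
have -> : nonshellability_constant * t ^+ 2 = W ^+ 2 * X ^+ 4.
  by rewrite /nonshellability_constant /t; field; rewrite !gt_eqF.
have -> : 2 * t * (c * X ^+ 2) = 2 * (W ^+ 2 * X ^+ 4).
  by rewrite /t; field; rewrite gt_eqF.
by lra.
Qed.

End NotShellable.

(** * Asymptotics *)

Section Limits.
Local Open Scope classical_set_scope.
Variable R : realType.
Implicit Types (alpha beta : R).

Lemma powR_nat_near beta (A : R) : 0 < beta ->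
  \forall n \near \oo, A <= n.+1%:R `^ beta.
Proof.
move=> b0; near=> n.
have An : `|A| `^ beta^-1 <= n%:R by near: n; exact: nbhs_infty_ger.
apply: (le_trans (ler_norm A)).
have -> : `|A| = (`|A| `^ beta^-1) `^ beta.
  by rewrite -powRrM mulVf ?gt_eqF // powRr1.
apply: ge0_ler_powR; rewrite ?nnegrE ?powR_ge0 ?(ltW b0) //.
by apply: le_trans An _; rewrite ler_nat.
Unshelve. all: by end_near.
Qed.

Lemma cvg_div_powR_nat beta (C : R) : 0 < beta ->
  (fun n => C / n.+1%:R `^ beta) @ \oo --> (0 : R).
Proof.
move=> b0; apply/cvgrPdist_le => e e0; near=> n.
have N0 : 0 < (n.+1%:R : R) `^ beta by rewrite powR_gt0.
rewrite sub0r normrN normrM normfV [X in _ / X]gtr0_norm // ler_pdivrMr //.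
rewrite -ler_pdivrMl // mulrC; near: n; exact: powR_nat_near.
Unshelve. all: by end_near.
Qed.

Lemma powR_nat_le1 n (e : R) : e <= 0 -> n.+1%:R `^ e <= 1.
Proof.
by move=> e0; rewrite -[leRHS](powRr0 n.+1%:R) ler_powR // ler1n.
Qed.

Lemma powR_nat_ge1 n (e : R) : 0 <= e -> 1 <= n.+1%:R `^ e.
Proof.
by move=> e0; rewrite -[leLHS](powRr0 n.+1%:R) ler_powR // ler1n.
Qed.

Definition edge_density alpha n : R := n.+1%:R `^ (- alpha).

Lemma edge_density01 alpha n : 0 <= alpha -> 0 <= edge_density alpha n <= 1.
Proof.
by move=> a0; rewrite powR_ge0 powR_nat_le1 ?oppr_le0.
Qed.

Lemma edge_densityX alpha n j k :
  n.+1%:R ^+ j * edge_density alpha n ^+ k = n.+1%:R `^ (j%:R - alpha * k%:R).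
Proof.
rewrite /edge_density -!powR_mulrn ?powR_ge0 // -powRrM -powRD ?mulNr //.
by apply/implyP => _; rewrite pnatr_eq0.
Qed.

Lemma aas_of_bound alpha (Q : forall n, sgraph n.+1 -> Prop) (u : nat -> R) :
  0 <= alpha -> u @ \oo --> (0 : R) ->
  (\forall n \near \oo, gnp_prob (edge_density alpha n) (fun g => ~ Q n g) <= u n) ->
  aas alpha Q.
Proof.
move=> a0 u0 Qu; rewrite /aas.
apply: (@squeeze_cvgr _ _ _ _ (fun n => 1 - u n) (fun=> 1)).
- near=> n; have p01 := edge_density01 n a0; rewrite gnp_le1 // andbT.
  rewrite lerBlDr -lerBlDl -gnp_not //; near: n; exact: Qu.
- rewrite -[X in _ --> X]subr0; apply: cvgB => //; exact: cvg_cst.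
- exact: cvg_cst.
Unshelve. all: by end_near.
Qed.

Lemma aas_imp alpha (P Q S : forall n, sgraph n.+1 -> Prop) :
  0 <= alpha -> aas alpha P -> aas alpha Q ->
  (forall n g, P n g -> Q n g -> S n g) -> aas alpha S.
Proof.
move=> a0 aP aQ PQS; rewrite /aas.
apply: (@squeeze_cvgr _ _ _ _ (fun n => gnp_prob (edge_density alpha n) (@P n) +
  gnp_prob (edge_density alpha n) (@Q n) - 1) (fun=> 1)).
- near=> n; have p01 := edge_density01 n a0; rewrite gnp_le1 // andbT.
  apply: (le_trans (gnp_and p01 _ _)); apply: gnp_le => // g [Pg Qg].
  exact: PQS.
- rewrite -[X in _ --> X](addrK 1); apply: cvgB; last exact: cvg_cst.
  exact: cvgD.
- exact: cvg_cst.
Unshelve. all: by end_near.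
Qed.

(** With [N] vertices, the expected number of paths with [j < l] interior vertices is at most
    [N^(j - alpha (j + 1))], and the exponent is at most [- eps]. *)
Lemma aas_far l alpha (a b : forall n, 'I_n.+1) : (0 < l)%N ->
  0 <= alpha -> l.-1%:R < alpha * l%:R ->
  aas alpha (fun n g => a n = b n \/ ~ leo (dist g (a n) (b n)) l).
Proof.
move=> l0 a0 al; pose eps := alpha - l.-1%:R / l%:R.
have l0' : (0 : R) < l%:R by rewrite ltr0n.
have eps0 : 0 < eps by rewrite subr_gt0 ltr_pdivrMr.
apply: (aas_of_bound a0 (cvg_div_powR_nat l%:R eps0)).
near=> n; have p01 := edge_density01 n a0.
have [abE|ab] := eqVneq (a n) (b n).
  rewrite /gnp_prob big_pred0 ?divr_ge0 ?powR_ge0 // => g.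
  by apply/asboolP => nab; apply: nab; left.
apply: (@le_trans _ _ (gnp_prob (edge_density alpha n)
    (fun g => leo (dist g (a n) (b n)) l))).
  apply: gnp_le => // g H; apply: contrapT => nl; apply: H; right; exact: nl.
apply: (le_trans (gnp_dist_bound p01 l ab)).
apply: (@le_trans _ _ (\sum_(j < l) (n.+1%:R `^ eps)^-1)); last first.
  by rewrite sumr_const card_ord mulr_natl.
apply: ler_sum => j _; rewrite edge_densityX -powRN; apply: ler_powR.
  by rewrite ler1n.
have jl : (j%:R : R) <= l.-1%:R by rewrite ler_nat -ltnS prednK.
have lE : (l%:R : R) = l.-1%:R + 1 by rewrite natr1 prednK.
have j0 : (0 : R) <= j%:R by [].
have aE : alpha * l%:R = l.-1%:R + eps * l%:R.
  by rewrite /eps mulrBl mulfVK ?gt_eqF // addrC subrK.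
have ej : 0 <= eps * l%:R * j%:R by rewrite !mulr_ge0 // ltW.
rewrite -(ler_pM2r l0') -natr1.
have -> : (j%:R - alpha * (j%:R + 1)) * l%:R =
    j%:R * l%:R - alpha * l%:R * (j%:R + 1) by ring.
by move: ej; rewrite aE lE; lra.
Unshelve. all: by end_near.
Qed.

Lemma aas_common l alpha : 0 <= alpha -> alpha < 2^-1 ->
  aas alpha (fun n g => forall (S : seq 'I_n.+1) (u w : 'I_n.+1),
    (size S <= l.+1)%N -> u != w ->
    exists y, [/\ y \notin S, adj g u y & adj g y w]).
Proof.
move=> a0 a2; pose gam := 1 - alpha * 2; pose d := l.+3.
have gam0 : 0 < gam by rewrite /gam; lra.
(* The exponential decay of the failure bound is weakened to the power [- gam k] of the number of
   vertices; [gam k >= d + 1] beats the union bound factor of exponent [d] with one power to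
   spare. *)
pose k := (Num.trunc (d.+1%:R / gam)).+1.
have dk : d.+1%:R <= gam * k%:R.
  by rewrite -ler_pdivrMl // mulrC ltW // truncnS_gt.
have k0 : (0 : R) < k%:R by rewrite ltr0n.
apply: (aas_of_bound a0 (cvg_div_powR_nat ((2 * k)%:R ^+ k) ltr01)).
near=> n; have p01 := edge_density01 n a0; have /andP[p0 p1] := p01.
have nd : (2 * d <= n.+1)%N.
  by apply: leqW; near: n; exact: nbhs_infty_ge.
apply: (le_trans (gnp_common_bound n.+1 p01 l.+1)); rewrite -/d.
set N : R := n.+1%:R; set q := edge_density alpha n ^+ 2.
have N0 : 0 < N by rewrite ltr0n.
have N1 : 1 <= N by rewrite ler1n.
pose M := (n.+1 - d)%N; rewrite -/M.
have qM : N `^ gam / 2 <= q * M%:R.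
  have NM : N <= 2 * M%:R.
    rewrite /N /M -natrM ler_nat; move: nd; clear; lia.
  have -> : N `^ gam = q * N.
    by rewrite [q * _]mulrC /q /N -[X in X * _]expr1 edge_densityX.
  rewrite -mulrA ler_wpM2l ?sqr_ge0 // ler_pdivrMr // mulrC //.
have powk : (N `^ gam / (2 * k)%:R) ^+ k <= expR (q * M%:R).
  have -> : q * M%:R = k%:R * (q * M%:R / k%:R) by field; rewrite gt_eqF.
  rewrite expRM_natl ler_pXn2r ?nnegrE ?expR_ge0 ?divr_ge0 ?powR_ge0 //.
  apply: le_trans (expR_ge1Dx _); rewrite natrM invfM mulrA -[leLHS]add0r.
  by rewrite lerD // ler_pM2r // invr_gt0.
have one_sub : (1 - q) ^+ M <= (expR (q * M%:R))^-1.
  have -> : (expR (q * M%:R))^-1 = expR (- q) ^+ M.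
    by rewrite -expRN -expRM_natl mulrN mulrC.
  have [->|M0] := posnP M; first by rewrite !expr0.
  rewrite ler_pXn2r ?nnegrE ?expR_ge0 ?subr_ge0 ?expr_le1 //.
  exact: expR_ge1Dx.
have pk0 : 0 < (N `^ gam / (2 * k)%:R) ^+ k.
  by rewrite exprn_gt0 // divr_gt0 ?powR_gt0 ?ltr0n.
apply: (@le_trans _ _ (N ^+ d * ((N `^ gam / (2 * k)%:R) ^+ k)^-1)).
  rewrite ler_wpM2l ?exprn_ge0 ?(ltW N0) //.
  by apply: (le_trans one_sub); rewrite lef_pV2 ?posrE ?expR_gt0.
rewrite expr_div_n invf_div mulrCA ler_wpM2l ?exprn_ge0 //.
rewrite powRr1 ?(ltW N0) // ler_pdivrMr ?exprn_gt0 ?powR_gt0 //.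
rewrite mulrC ler_pdivlMr // -exprSr -powR_mulrn ?(ltW N0) //.
by rewrite -[leRHS]powR_mulrn ?powR_ge0 // -powRrM; apply: ler_powR.
Unshelve. all: by end_near.
Qed.

(** In this range the expected number of paths of length [l] does not decay, so whenever [a n] and
    [b n] differ for large [n], non-shellability has probability at least a positive constant,
    against the limit 1. *)
Lemma eventually_diagonal l alpha (a b : forall n, 'I_n.+1) :
  (3 <= l)%N -> 2^-1 <= alpha -> alpha * l%:R <= l.-1%:R ->
  aas alpha (fun n g => shellable (ET g l (a n) (b n)) /\
                        shellable (ET g l.-1 (a n) (b n))) ->
  \forall n \near \oo, a n = b n.
Proof.
case: l => // r r1 a2 al aS; rewrite ltnS in r1.
have a0 : 0 <= alpha by apply: le_trans a2; rewrite invr_ge0.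
have rr : r%:R <= (r.+1%:R : R) by rewrite ler_nat.
have a1 : alpha <= 1.
  rewrite -(@ler_pM2r _ r.+1%:R) ?ltr0n // mul1r; exact: le_trans rr.
have c0 := nonshellability_constant_gt0 R r.
move/cvgrPdist_lt: aS => /(_ _ c0) aS.
near=> n; apply: contrapT => /eqP ab.
have p01 := edge_density01 n a0.
have N1 : 1 <= (n.+1%:R : R) by rewrite ler1n.
have p2 : edge_density alpha n ^+ 2 * n.+1%:R <= 1.
  rewrite mulrC -[X in X * _]expr1 edge_densityX.
  by apply: powR_nat_le1; lra.
have np : 1 <= n.+1%:R * edge_density alpha n.
  rewrite -[X in X * _]expr1 -[X in _ * X]expr1 edge_densityX.
  by apply: powR_nat_ge1; lra.
have nrp : 1 <= n.+1%:R ^+ r * edge_density alpha n ^+ r.+1.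
  by rewrite edge_densityX powR_nat_ge1 // subr_ge0.
have nK : 2 * (2 * r.+2)%:R ^+ 2 <= (n.+1%:R : R).
  rewrite -natrX -natrM ler_nat; apply: leqW; near: n; exact: nbhs_infty_ge.
have nr : (4 * r + 4 <= n.+1)%N.
  by apply: leqW; near: n; exact: nbhs_infty_ge.
have := not_shellable_ge r1 ab p01 p2 np nrp nK nr.
rewrite gnp_not // => cn.
have : `|1 - gnp_prob (edge_density alpha n)
    (fun g => shellable (ET g r.+1 (a n) (b n)) /\
              shellable (ET g r (a n) (b n)))| < nonshellability_constant R r.
  by near: n; exact: aS.
rewrite ger0_norm ?subr_ge0 ?gnp_le1 //; apply/negP; rewrite -leNgt.
apply: (le_trans cn); rewrite lerB //; apply: gnp_le => // g [].
by [].
Unshelve. all: by end_near.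
Qed.

End Limits.

(** * Assembly of the three regimes of [alpha] *)

Theorem theorem24 (R : realType) (l : nat) (hl : (3 <= l)%N)
    (alpha : R) (halpha : (0 <= alpha)%R) (a b : forall n : nat, 'I_n.+1) :
  aas alpha (fun n g => shellable (ET g l (a n) (b n)) /\
                        shellable (ET g l.-1 (a n) (b n))) ->
  aas alpha (fun n g => forall k : nat,
                        torsion_free (EMH g l (a n) (b n) k)).
Proof.
move=> aS; have l0 : (0 < l)%N by exact: leq_trans hl.
have [a2|a2] := ltP alpha 2^-1.
  apply: (aas_imp halpha aS (aas_common l halpha a2)) => n g [sl sl1] common k.
  exact: torsion_free_of_common.
have trivial_egen n (g : sgraph n.+1) : a n = b n \/ ~ leo (dist g (a n) (b n)) l ->
    forall k, torsion_free (EMH g l (a n) (b n) k).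
  move=> far k; apply: torsion_free_EMH_egen0 => x; case: far => [ab|].
    by have := egen_neq l0 x; rewrite ab eqxx.
  by apply; exact: egen_dist x.
have [al|al] := ltP l.-1%:R (alpha * l%:R).
  apply: (aas_imp halpha aS (aas_far a b l0 halpha al)) => n g _; exact: trivial_egen.
(* In the remaining window the hypothesis leaves only [a n = b n] for large [n], where there are no
   generators. *)
have diag := eventually_diagonal hl a2 al aS.
apply: (aas_of_bound halpha (u := fun=> 0)); first exact: cvg_cst.
near=> n; rewrite /gnp_prob big_pred0 // => g; apply/asboolP; apply.
by apply: trivial_egen; left; near: n.
Unshelve. all: by end_near.
Qed.
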